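(* Let $m\in\mathbb{N}$, $R\geq 0$ and $V\in H_{per}^{-m}[-1,1]$. For any $W\in H_{per}^{-m}[-1,1]$ with $\|W-V\|_{m}\leq R$ (that is, $W-V\in H_{per}^{m}[-1,1]$ with $H_{per}^{m}$-norm at most $R$), the eigenvalues $(\lambda_{k}(m,W))_{k\geq 0}$ of $L_m(W)$ satisfy the asymptotic formula $$\lambda_{2n-1}(m,W),\ \lambda_{2n}(m,W)=n^{2m}\pi^{2m}+o(n^{m}),\qquad n\to\infty,$$ uniformly in $W$. Explicitly: for every $\delta>0$ there is $n_0\in\mathbb{N}$ (depending only on $m$, $V$, $R$, $\delta$) such that $|\lambda_{2n-i}(m,W)-n^{2m}\pi^{2m}|\leq\delta n^{m}$ for $i=0,1$, all $n\geq n_0$ and all such $W$.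
   Context: For $s\in\mathbb{R}$, $H_{per}^{s}[-1,1]$ is the complex Sobolev space of 2-periodic functions or distributions $f=\sum_{k\in\mathbb{Z}}\hat f(k)e^{ik\pi x}$ with $\|f\|_{s}:=\left(\sum_{k\in\mathbb{Z}}\langle k\rangle^{2s}|\hat f(k)|^{2}\right)^{1/2}<\infty$, where $\langle k\rangle:=1+|k|$ and $\hat f(k):=\langle f,e^{ik\pi x}\rangle$; the brackets denote the sesquilinear pairing between $H_{per}^{s}[-1,1]$ and $H_{per}^{-s}[-1,1]$ extending the inner product $\langle f,g\rangle=\frac12\int_{-1}^{1}f(x)\overline{g(x)}\,dx$ on $L^2_{per}[-1,1]$. For $m\in\mathbb{N}$ and a (complex-valued) distribution $V\in H_{per}^{-m}[-1,1]$, $L_m(V):=(-1)^{m}\frac{d^{2m}}{dx^{2m}}+V$ is the unbounded linear operator in the Hilbert space $H_{per}^{-m}[-1,1]$ with inner product $\langle f,g\rangle_{-m}=\sum_{k}\langle k\rangle^{-2m}\hat f(k)\overline{\hat g(k)}$ and with domain $H_{per}^{m}[-1,1]$. Here $V$ acts on $f\in H_{per}^{m}[-1,1]$ by multiplication $f\mapsto V\cdot f\in H_{per}^{-m}[-1,1]$, defined through Fourier coefficients by $\widehat{V\cdot f}(k)=\sum_{j\in\mathbb{Z}}\hat V(k-j)\hat f(j)$. The spectrum of $L_m(V)$ is discrete and consists of a sequence of eigenvalues $\lambda_k=\lambda_k(m,V)$, $k\in\mathbb{Z}_+=\{0,1,2,\dots\}$, with $\operatorname{Re}\lambda_k\to+\infty$,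 enumerated with algebraic multiplicities and ordered lexicographically: for each $k$, either $\operatorname{Re}\lambda_k<\operatorname{Re}\lambda_{k+1}$, or $\operatorname{Re}\lambda_k=\operatorname{Re}\lambda_{k+1}$ and $\operatorname{Im}\lambda_k\leq\operatorname{Im}\lambda_{k+1}$. *)

(* Defs.v *)
From HB Require Import structures.
From mathcomp Require Import all_boot all_order all_algebra.
From mathcomp Require Import complex.
From mathcomp Require Import all_classical all_reals all_analysis.

Set Implicit Arguments.
Unset Strict Implicit.
Unset Printing Implicit Defensive.

Import Order.TTheory GRing.Theory Num.Theory.
Import numFieldNormedType.Exports.

Local Open Scope classical_set_scope.
Local Open Scope complex_scope.
Local Open Scope ring_scope.

(** A 2-periodic distribution [f = \sum_k f^(k) e^{i k pi x}] is represented by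
    its sequence of Fourier coefficients [k |-> f^(k)]; [sobolev s] below is
    then [H_per^s[-1,1]]. *)
Definition fourier (R : realType) : Type := int -> R[i].

Section Defs.
Variable R : realType.
Implicit Types (f g V : fourier R) (z : R[i]) (s : R) (m : nat).

Definition cabs z : R := ComplexField.Normc.normc z.

Definition japanese (k : int) : R := 1 + `|k|%N%:R.

Definition sobolev_sqnorm s f : \bar R :=
  \esum_(k in [set: int]) (japanese k `^ (2 * s) * cabs (f k) ^+ 2)%:E.

Definition sobolev s : set (fourier R) :=
  [set f | (sobolev_sqnorm s f < +oo)%E].

(** Meaningful for [f] in [sobolev s] only, since [fine +oo = 0]. *)
Definition sobolev_norm s f : R := Num.sqrt (fine (sobolev_sqnorm s f)).

(** Sums of absolutely convergent families indexed by [int]: positive part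
    minus negative part, for the real and imaginary parts separately. *)
Definition zsumr (u : int -> R) : R :=
  fine (\esum_(j in [set: int]) (Num.max (u j) 0)%:E) -
  fine (\esum_(j in [set: int]) (Num.max (- u j) 0)%:E).

Definition zsum (u : int -> R[i]) : R[i] :=
  zsumr (fun j => complex.Re (u j)) +i* zsumr (fun j => complex.Im (u j)).

(** The family summed here is absolutely convergent when [V] is in
    [sobolev (- m)] and [f] in [sobolev m], by Cauchy-Schwarz and
    [japanese k <= japanese (k - j) * japanese j]. *)
Definition fmul V f : fourier R :=
  fun k => zsum (fun j => V (k - j) * f j).

Definition fderiv f : fourier R :=
  fun k => (0 +i* (k%:~R * pi)) * f k.

(** The domain of [Lop m V] is [sobolev m]; it is imposed wherever the operator
    is used. *)
Definition Lop m V f : fourier R :=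
  fun k => (-1) ^+ m * iter (2 * m) fderiv f k + fmul V f k.

Definition Lshift m V z f : fourier R := fun k => Lop m V f k - z * f k.

(** [z] is in the resolvent set when [L - z] is a bijection from the domain
    [sobolev m] onto the Hilbert space [sobolev (- m)], with an inverse bounded
    on [sobolev (- m)]. *)
Definition resolvent_set m V : set R[i] :=
  [set z | (forall g, sobolev (- m%:R) g ->
              exists! f, sobolev m%:R f /\ Lshift m V z f = g) /\
           exists C : R, forall f, sobolev m%:R f ->
              sobolev_norm (- m%:R) f <=
              C * sobolev_norm (- m%:R) (Lshift m V z f)].

Definition spectrum m V : set R[i] := ~` resolvent_set m V.

(** Kernel of [(L - z)^p], with the domain of the power of an unbounded
    operator: all of [f, (L - z) f, ..., (L - z)^(p-1) f] lie in [sobolev m]. *)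
Fixpoint ker_pow m V z (p : nat) : set (fourier R) :=
  if p is q.+1
  then [set f | sobolev m%:R f /\ ker_pow m V z q (Lshift m V z f)]
  else [set f | forall k, f k = 0].

Definition root_space m V z : set (fourier R) :=
  [set f | exists p, ker_pow m V z p f].

(** The root space has a basis with [d] elements. *)
Definition alg_mult m V z (d : nat) : Prop :=
  exists e : 'I_d -> fourier R,
    (forall i, root_space m V z (e i)) /\
    (forall f, root_space m V z f ->
       exists! c : {ffun 'I_d -> R[i]},
         forall k, f k = \sum_(i < d) c i * e i k).

Definition lex_le (z w : R[i]) : Prop :=
  complex.Re z < complex.Re w \/
  (complex.Re z = complex.Re w /\ complex.Im z <= complex.Im w).

(** [lam] is the sequence of eigenvalues of [L_m(V)]; these requirements
    determine it uniquely. *)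
Definition eigenvalue_sequence m V (lam : nat -> R[i]) : Prop :=
  [/\ spectrum m V = range lam,
      forall z, exists2 d : nat,
        alg_mult m V z d & ([set k | lam k = z] #= `I_d)%card,
      forall k, lex_le (lam k) (lam k.+1) &
      (complex.Re (lam k) @[k --> \oo] --> +oo)%R].

End Defs.

(* Main.v *)
Require Import Defs.
From mathcomp Require Import all_boot all_order all_algebra.
From mathcomp Require Import complex.
From mathcomp Require Import all_classical all_reals all_analysis.
From mathcomp Require Import ring lra zify.

(** Write d_k = (k pi)^(2m) and D for the diagonal operator with entries d_k, so
    that L = D + W with W a form perturbation of D.

    The whole proof rests on one estimate. Let q_k be a lower bound for
    |d_k - z|, where the real part of z lies between the midpoints below and
    above the level d_n and z is at distance at least delta n^m from d_n. The Hilbert-Schmidt norm of the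
    matrix with entries W_(k-j) / sqrt (q_k q_j) tends to 0 as n grows,
    uniformly over the admissible W ([form_small_uniform]): the rough part V is
    fixed, so that its high frequencies have small norm, and the smooth part
    W - V is controlled by r alone.

    Localisation. If L f = z f, then the energy sum q_k |f_k|^2 is at most half
    of itself, so f = 0 ([no_eigenvector]). An eigenvalue whose real part lies
    between the midpoints below and above d_n is therefore within delta n^m of
    d_n.

    Counting. It remains to see that exactly 2n - 1 eigenvalues, counted with
    algebraic multiplicity, have real part less than a, the midpoint of d_(n-1)
    and d_n. Riesz projections are replaced by an indefinite form. Let J be the
    diagonal sign of d_k - a, negative on the 2n - 1 modes |k| < n. The same
    estimate gives Re <(L - a) f, J f> > 0 for f <> 0 ([accretive]). By
    Lyapunov's theorem ([lyapunov]) the form <f, J f> is negative on every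
    finite-dimensional L-invariant space on which the eigenvalues of L have
    real part less than a; such a space projects injectively to the modes
    |k| < n, and its dimension is at most 2n - 1 ([index_upper]). Conversely
    each Galerkin truncation of L has, by the same theorem, a J-negative
    invariant space of dimension exactly 2n - 1 ([galerkin_step]). Such a space
    is a graph over the modes |k| < n with energy bounded independently of the
    truncation, and a limit of these graphs along an ultrafilter is an
    L-invariant space of dimension 2n - 1 ([invariant_family]), spanned by root
    vectors for eigenvalues with real part less than a ([eigenvalue_count]).

    Counting at n and at n + 1 shows that the eigenvalues numbered 2n - 1 and
    2n are the ones to which the localisation at d_n applies. *)

Set Implicit Arguments.
Unset Strict Implicit.
Unset Printing Implicit Defensive.

Import Order.TTheory GRing.Theory Num.Theory.
Local Open Scope classical_set_scope.
Local Open Scope complex_scope.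
Local Open Scope ring_scope.

(** * The modulus of a complex number *)

Section Modulus.
Variable R : realType.
Implicit Types z w : R[i].

Lemma cabs_ge0 z : 0 <= cabs z.
Proof. by case: z => a b; apply: sqrtr_ge0. Qed.

Lemma cabs0 : cabs (0 : R[i]) = 0.
Proof. exact: ComplexField.Normc.normc0. Qed.

Lemma cabs_eq0 z : cabs z = 0 -> z = 0.
Proof. exact: ComplexField.Normc.eq0_normc. Qed.

Lemma cabs_gt0 z : z != 0 -> 0 < cabs z.
Proof.
move=> z0; rewrite lt_def cabs_ge0 andbT; apply: contra z0 => /eqP /cabs_eq0 ->.
exact: eqxx.
Qed.

Lemma cabsM z w : cabs (z * w) = cabs z * cabs w.
Proof. exact: ComplexField.Normc.normcM. Qed.

Lemma cabsN z : cabs (- z) = cabs z.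
Proof. exact: normcN. Qed.

Lemma cabsD z w : cabs (z + w) <= cabs z + cabs w.
Proof. exact: le_normcD. Qed.

Lemma cabsB z w : cabs (z - w) <= cabs z + cabs w.
Proof. by rewrite -(cabsN w) cabsD. Qed.

Lemma cabs_distC z w : cabs (z - w) = cabs (w - z).
Proof. by rewrite -cabsN opprB. Qed.

Lemma cabs_real (x : R) : cabs x%:C = `|x|.
Proof. by rewrite /cabs /= expr0n addr0 sqrtr_sqr. Qed.

Lemma cabs_conj z : cabs (conjc z) = cabs z.
Proof. by case: z => a b; rewrite /cabs /= sqrrN. Qed.

Lemma cabs_sum (I : Type) (s : seq I) (F : I -> R[i]) :
  cabs (\sum_(i <- s) F i) <= \sum_(i <- s) cabs (F i).
Proof.
elim: s => [|i s IH]; first by rewrite !big_nil cabs0.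
by rewrite !big_cons (le_trans (cabsD _ _))// lerD2l.
Qed.

Lemma Re_le_cabs z : `|complex.Re z| <= cabs z.
Proof.
by case: z => a b; rewrite /cabs /= -sqrtr_sqr ler_wsqrtr// lerDl sqr_ge0.
Qed.

Lemma Im_le_cabs z : `|complex.Im z| <= cabs z.
Proof.
by case: z => a b; rewrite /cabs /= -sqrtr_sqr ler_wsqrtr// lerDr sqr_ge0.
Qed.

Lemma cabs_le_ReIm z : cabs z <= `|complex.Re z| + `|complex.Im z|.
Proof.
rewrite {1}(complexE z); apply: (le_trans (cabsD _ _)).
rewrite cabsM !cabs_real lerD2l.
by rewrite {1}/cabs /= expr0n expr1n add0r sqrtr1 mul1r.
Qed.

Lemma mul_conjc z : z * conjc z = (cabs z ^+ 2)%:C.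
Proof.
case: z => a b; rewrite /cabs /= sqr_sqrtr ?addr_ge0 ?sqr_ge0//.
by apply/eqP; rewrite eq_complex /=; apply/andP; split; apply/eqP; ring.
Qed.

Lemma ReD z w : complex.Re (z + w) = complex.Re z + complex.Re w.
Proof. by case: z; case: w. Qed.

Lemma ReN z : complex.Re (- z) = - complex.Re z.
Proof. by case: z. Qed.

Lemma ImD z w : complex.Im (z + w) = complex.Im z + complex.Im w.
Proof. by case: z; case: w. Qed.

Lemma ImN z : complex.Im (- z) = - complex.Im z.
Proof. by case: z. Qed.

Lemma ReZ (x : R) z : complex.Re (x%:C * z) = x * complex.Re z.
Proof. by case: z => a b /=; rewrite mul0r subr0. Qed.

Lemma Re_sum (I : Type) (s : seq I) (F : I -> R[i]) :
  complex.Re (\sum_(i <- s) F i) = \sum_(i <- s) complex.Re (F i).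
Proof. by elim/big_rec2: _ => // i y x _ <-; rewrite ReD. Qed.

Lemma Im_sum (I : Type) (s : seq I) (F : I -> R[i]) :
  complex.Im (\sum_(i <- s) F i) = \sum_(i <- s) complex.Im (F i).
Proof. by elim/big_rec2: _ => // i y x _ <-; rewrite ImD. Qed.

End Modulus.

(** * Sums over the integers *)

Section Sums.
Variable R : realType.
Implicit Types (u v : int -> R[i]) (a b : int -> R) (s t : seq int).

Definition sum_le a (M : R) := forall s, uniq s -> \sum_(k <- s) a k <= M.

(** Convergence of the net of finite partial sums, ordered by inclusion. *)
Definition has_sum u (l : R[i]) := forall e : R, 0 < e ->
  exists s0, forall s, uniq s -> {subset s0 <= s} ->
    cabs (\sum_(k <- s) u k - l) <= e.

Lemma sum_le_sub a s t : (forall k, 0 <= a k) -> uniq s -> uniq t ->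
  {subset s <= t} -> \sum_(k <- s) a k <= \sum_(k <- t) a k.
Proof.
move=> a0 us ut st.
have p : perm_eq s [seq k <- t | k \in s].
  apply: uniq_perm; rewrite ?filter_uniq// => k.
  by rewrite mem_filter; case E : (k \in s) => //=; rewrite st.
rewrite (perm_big _ p) /= big_filter (bigID (mem s) predT) /= lerDl.
by apply: sumr_ge0.
Qed.

Lemma sum_le_ge0 a M : sum_le a M -> 0 <= M.
Proof. by move=> /(_ [::] isT); rewrite big_nil. Qed.

Lemma sum_le_term a M k : sum_le a M -> a k <= M.
Proof. by move=> /(_ [:: k] isT); rewrite big_seq1. Qed.

Lemma sum_le_le a b M : (forall k, a k <= b k) -> sum_le b M -> sum_le a M.
Proof. by move=> ab bM s /bM; apply: le_trans; apply: ler_sum. Qed.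

Lemma sum_le_inj a M (f : int -> int) : injective f -> sum_le a M ->
  sum_le (a \o f) M.
Proof.
move=> fi aM s us; have := aM [seq f k | k <- s].
by rewrite map_inj_uniq// big_map; apply.
Qed.

Lemma sum_leD a b M N : sum_le a M -> sum_le b N ->
  sum_le (fun k => a k + b k) (M + N).
Proof. by move=> aM bN s us; rewrite big_split lerD// ?aM ?bN. Qed.

Lemma sum_leZ a M c : 0 <= c -> sum_le a M -> sum_le (fun k => c * a k) (c * M).
Proof. by move=> c0 aM s us; rewrite -mulr_sumr ler_wpM2l// aM. Qed.

Lemma sum_le_esum a M :
  (\esum_(k in [set: int]) (a k)%:E <= M%:E)%E -> sum_le a M.
Proof.
move=> aM s us; rewrite -lee_fin; apply: le_trans aM.
apply: esum_ge; exists [set` s]; first by split=> //; exact: finite_seq.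
by rewrite -fsbig_seq// sumEFin.
Qed.

(** The exact value A of a nonnegative series, as the supremum of its finite
    sums. The smallness arguments below absorb a term e * A into A, for
    which a mere upper bound would not do. *)
Lemma sum_le_attained a M : (forall k, 0 <= a k) -> sum_le a M ->
  exists2 A, sum_le a A & forall e : R, 0 < e ->
    exists2 s0, uniq s0 & A - e <= \sum_(k <- s0) a k.
Proof.
move=> a0 aM; set E := [set x : R | exists2 s, uniq s & x = \sum_(k <- s) a k].
have hE : has_sup E.
  split; first by exists 0; exists [::]; rewrite ?big_nil.
  by exists M => x [s us ->]; apply: aM.
exists (sup E) => [s us|e e0]; first by apply: ub_le_sup; [case: hE|exists s].
by have [_ [s us ->] h] := sup_adherent e0 hE; exists s; rewrite ?ltW.
Qed.

Lemma esum_approx a M : (forall k, 0 <= a k) -> sum_le a M ->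
  forall e : R, 0 < e -> exists s0, forall s, uniq s -> {subset s0 <= s} ->
   `|\sum_(k <- s) a k - fine (\esum_(k in [set: int]) (a k)%:E)| <= e.
Proof.
move=> a0 aM e e0.
have [A aA hA] := sum_le_attained a0 aM.
have EA : \esum_(k in [set: int]) (a k)%:E = A%:E.
  apply/eqP; rewrite eq_le; apply/andP; split.
    apply: ub_ereal_sup => _ [X [fX _] <-].
    rewrite fsbig_finite//= sumEFin lee_fin; exact/aA/finmap.fset_uniq.
  apply/lee_addgt0Pr => d d0.
  have [s us h] := hA _ d0; rewrite -leeBlDr// -EFinB.
  apply: esum_ge; exists [set` s]; first by split=> //; exact: finite_seq.
  by rewrite -fsbig_seq// sumEFin lee_fin.
rewrite EA /=; have [s0 us0 h] := hA _ e0; exists s0 => s us ss.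
have := aA _ us; have := sum_le_sub a0 us0 us ss.
by rewrite ler_norml => *; apply/andP; split; lra.
Qed.

Lemma zsumr_approx a M : sum_le (fun k => `|a k|) M ->
  forall e : R, 0 < e -> exists s0, forall s, uniq s -> {subset s0 <= s} ->
   `|\sum_(k <- s) a k - zsumr a| <= e.
Proof.
move=> aM e e0; have e2 : 0 < e / 2 by rewrite divr_gt0.
have p0 (b : int -> R) k : 0 <= Num.max (b k) 0 by rewrite le_max lexx orbT.
have pM : sum_le (fun k => Num.max (a k) 0) M.
  by apply: sum_le_le aM => k; rewrite ge_max ler_norm normr_ge0.
have nM : sum_le (fun k => Num.max (- a k) 0) M.
  by apply: sum_le_le aM => k; rewrite ge_max -normrN ler_norm normr_ge0.
have [s1 h1] := esum_approx (p0 _) pM e2.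
have [s2 h2] := esum_approx (p0 (fun k => - a k)) nM e2.
exists (s1 ++ s2) => s us ss; rewrite /zsumr.
have -> : \sum_(k <- s) a k =
    \sum_(k <- s) Num.max (a k) 0 - \sum_(k <- s) Num.max (- a k) 0.
  rewrite -sumrB; apply: eq_bigr => k _.
  case: (lerP 0 (a k)) => h; first by rewrite max_r ?oppr_le0// subr0.
  by rewrite max_l ?oppr_ge0 ?ltW// sub0r opprK.
have /(h1 s us) H1 : {subset s1 <= s} by move=> k k1; rewrite ss// mem_cat k1.
have /(h2 s us) H2 : {subset s2 <= s}.
  by move=> k k1; rewrite ss// mem_cat k1 orbT.
by move: H1 H2; rewrite !ler_norml => /andP[? ?] /andP[? ?]; lra.
Qed.

(** Once the sum is known to be a limit of finite sums, linearity and bounds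
    are those of limits. *)
Lemma zsumP u M : sum_le (fun k => cabs (u k)) M -> has_sum u (zsum u).
Proof.
move=> uM e e0; have e2 : 0 < e / 2 by rewrite divr_gt0.
have rM : sum_le (fun k => `|complex.Re (u k)|) M.
  by apply: sum_le_le uM => k; apply: Re_le_cabs.
have iM : sum_le (fun k => `|complex.Im (u k)|) M.
  by apply: sum_le_le uM => k; apply: Im_le_cabs.
have [s1 h1] := zsumr_approx rM e2; have [s2 h2] := zsumr_approx iM e2.
exists (s1 ++ s2) => s us ss.
have /(h1 s us) H1 : {subset s1 <= s} by move=> k k1; rewrite ss// mem_cat k1.
have /(h2 s us) H2 : {subset s2 <= s}.
  by move=> k k1; rewrite ss// mem_cat k1 orbT.
apply: le_trans (cabs_le_ReIm _) _.
by rewrite ReD ImD ReN ImN Re_sum Im_sum /=; lra.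
Qed.

(** Limits along several families are compared on one common list, which is
    why the list may be required to contain a given one. *)
Lemma has_sum_near u l e s1 : has_sum u l -> 0 < e -> exists s,
  [/\ uniq s, {subset s1 <= s} & cabs (\sum_(k <- s) u k - l) <= e].
Proof.
move=> ul e0; have [s0 h] := ul e e0; exists (undup (s0 ++ s1)).
have us := undup_uniq (s0 ++ s1); split=> // [k k1|].
  by rewrite mem_undup mem_cat k1 orbT.
by apply: h => // k k0; rewrite mem_undup mem_cat k0.
Qed.

Lemma has_sum_uniq u l l' : has_sum u l -> has_sum u l' -> l = l'.
Proof.
move=> ul ul'; apply/eqP; rewrite -subr_eq0; apply/negPn/negP => /cabs_gt0 d0.
have e0 : 0 < cabs (l - l') / 3 by rewrite divr_gt0.
have [s0 h] := ul' _ e0; have [s [us ss hs]] := has_sum_near s0 ul e0.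
have := h s us ss; have := cabsD (l - \sum_(k <- s) u k) (\sum_(k <- s) u k - l').
by rewrite addrA subrK (cabs_distC l); lra.
Qed.

Lemma eq_has_sum u v l : u =1 v -> has_sum u l -> has_sum v l.
Proof.
move=> uv ul e /ul[s0 h]; exists s0 => s us ss.
by rewrite -(eq_bigr _ (fun k _ => uv k)) h.
Qed.

Lemma has_sumD u v l l' : has_sum u l -> has_sum v l' ->
  has_sum (fun k => u k + v k) (l + l').
Proof.
move=> ul vl e e0; have e2 : 0 < e / 2 by rewrite divr_gt0.
have [s1 h1] := ul _ e2; have [s2 h2] := vl _ e2.
exists (s1 ++ s2) => s us ss.
have /(h1 s us) H1 : {subset s1 <= s} by move=> k k1; rewrite ss// mem_cat k1.
have /(h2 s us) H2 : {subset s2 <= s}.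
  by move=> k k1; rewrite ss// mem_cat k1 orbT.
by rewrite big_split opprD addrACA; apply: le_trans (cabsD _ _) _; lra.
Qed.

Lemma has_sumZ u l (c : R[i]) : has_sum u l ->
  has_sum (fun k => c * u k) (c * l).
Proof.
move=> ul e e0; have c0 : 0 < cabs c + 1 by rewrite ltr_wpDl ?cabs_ge0.
have [s0 h] := ul (e / (cabs c + 1)) (divr_gt0 e0 c0).
exists s0 => s us ss; rewrite -mulr_sumr -mulrBr cabsM.
apply: le_trans (_ : (cabs c + 1) * (e / (cabs c + 1)) <= _).
  by rewrite ler_pM ?cabs_ge0 ?h// lerDl.
by rewrite mulrC divfK// gt_eqF.
Qed.

Lemma has_sum0 : has_sum (fun=> 0) 0.
Proof. by move=> e e0; exists [::] => s _ _; rewrite big1// subrr cabs0 ltW. Qed.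

Lemma has_sum_lc (I : Type) (r : seq I) (c : I -> R[i]) (F : I -> int -> R[i]) l :
  (forall i, has_sum (F i) (l i)) ->
  has_sum (fun k => \sum_(i <- r) c i * F i k) (\sum_(i <- r) c i * l i).
Proof.
move=> Fl; elim: r => [|i r IH].
  by rewrite big_nil; apply: eq_has_sum has_sum0 => k; rewrite big_nil.
rewrite big_cons; apply: eq_has_sum (has_sumD (has_sumZ (c i) (Fl i)) IH) => k.
by rewrite big_cons.
Qed.

Lemma has_sum_conj u l : has_sum u l ->
  has_sum (fun k => conjc (u k)) (conjc l).
Proof.
move=> ul e /ul[s0 h]; exists s0 => s us ss.
by rewrite -rmorph_sum -rmorphB cabs_conj h.
Qed.

Lemma has_sum_supp u s0 : uniq s0 -> (forall k, k \notin s0 -> u k = 0) ->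
  has_sum u (\sum_(k <- s0) u k).
Proof.
move=> us0 u0 e e0; exists s0 => s us ss.
rewrite (bigID (mem s0) predT) /= [X in _ + X - _]big1; last by move=> k /u0.
rewrite -big_filter addr0 (perm_big s0) ?subrr ?cabs0 ?ltW//.
apply: uniq_perm; rewrite ?filter_uniq// => k.
by rewrite mem_filter; case E : (k \in s0) => //=; rewrite ss.
Qed.

Lemma has_sum_Re_ge u l s0 B : has_sum u l ->
  (forall s, uniq s -> {subset s0 <= s} ->
    B <= \sum_(k <- s) complex.Re (u k)) -> B <= complex.Re l.
Proof.
move=> ul hB; apply/ler_addgt0Pr => e e0.
have [s [us ss hs]] := has_sum_near s0 ul e0.
have := hB s us ss; have := le_trans (Re_le_cabs _) hs.
by rewrite ReD ReN Re_sum ler_norml => /andP[? ?]; lra.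
Qed.

Lemma has_sum_cabs_le u l M : has_sum u l ->
  (forall s, uniq s -> \sum_(k <- s) cabs (u k) <= M) -> cabs l <= M.
Proof.
move=> ul hM; apply/ler_addgt0Pr => e e0.
have [s [us _ hs]] := has_sum_near [::] ul e0.
have := hM s us; have := cabs_sum s u.
have := cabsD (l - \sum_(k <- s) u k) (\sum_(k <- s) u k).
by rewrite subrK (cabs_distC l); lra.
Qed.

End Sums.

(** * Lyapunov's theorem for matrices *)

Section Linear.
Variable R : realType.
Local Notation C := R[i].

Definition adjmx p n (A : 'M[C]_(p, n)) : 'M[C]_(n, p) :=
  map_mx (@conjc R) A^T.

Definition hform n (H : 'M[C]_n) (x y : 'rV[C]_n) : C :=
  (x *m H *m adjmx y) 0 0.

Lemma adjmx_mul p n q (A : 'M[C]_(p, n)) (B : 'M[C]_(n, q)) :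
  adjmx (A *m B) = adjmx B *m adjmx A.
Proof. by rewrite /adjmx trmx_mul map_mxM. Qed.

Lemma adjmxK p n (A : 'M[C]_(p, n)) : adjmx (adjmx A) = A.
Proof. by apply/matrixP => i j; rewrite !mxE conjcK. Qed.

Lemma adjmxD p n (A B : 'M[C]_(p, n)) : adjmx (A + B) = adjmx A + adjmx B.
Proof. by apply/matrixP => i j; rewrite !mxE rmorphD. Qed.

Lemma adjmxZ p n (a : C) (A : 'M[C]_(p, n)) :
  adjmx (a *: A) = conjc a *: adjmx A.
Proof. by apply/matrixP => i j; rewrite !mxE rmorphM. Qed.

Lemma hform_mull n p (H : 'M[C]_n) (P : 'M[C]_(p, n)) x y :
  hform H (x *m P) (y *m P) = hform (P *m H *m adjmx P) x y.
Proof. by rewrite /hform adjmx_mul !mulmxA. Qed.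

Lemma hform_conj n (H : 'M[C]_n) x y : adjmx H = H ->
  hform H y x = conjc (hform H x y).
Proof.
move=> hH; rewrite /hform -{1}hH -{1}(adjmxK y) -!adjmx_mul mulmxA.
by rewrite mxE mxE.
Qed.

Lemma adjmx_congr p n (H : 'M[C]_n) (P : 'M[C]_(p, n)) : adjmx H = H ->
  adjmx (P *m H *m adjmx P) = P *m H *m adjmx P.
Proof. by move=> hH; rewrite !adjmx_mul adjmxK hH mulmxA. Qed.

Lemma hformDl n (H : 'M[C]_n) x y z : hform H (x + y) z = hform H x z + hform H y z.
Proof. by rewrite /hform !mulmxDl mxE. Qed.

Lemma hformDr n (H : 'M[C]_n) x y z : hform H z (x + y) = hform H z x + hform H z y.
Proof. by rewrite /hform adjmxD mulmxDr mxE. Qed.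

Lemma hformZl n (H : 'M[C]_n) a x z : hform H (a *: x) z = a * hform H x z.
Proof. by rewrite /hform -!scalemxAl mxE. Qed.

Lemma hformZr n (H : 'M[C]_n) a x z : hform H z (a *: x) = conjc a * hform H z x.
Proof. by rewrite /hform adjmxZ -scalemxAr mxE. Qed.

Lemma real_of_conj (z : C) : conjc z = z -> z = (complex.Re z)%:C.
Proof.
case: z => a b [] bN; apply/eqP; rewrite eq_complex /= eqxx /=.
by apply/eqP; lra.
Qed.

(** By induction on the size. The first basis vector e is an eigenvector of
    T, so H is negative along e. The rows of P span the H-orthogonal
    complement of e; modulo e, the matrix T acts on them through its lower
    right block, which is again triangular and satisfies the same positivity
    for the restriction of H. *)
Lemma lyapunov_trig n (T H : 'M[C]_n) : adjmx H = H -> is_trig_mx T ->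
  (forall i, complex.Re (T i i) < 0) ->
  (forall x, x != 0 -> 0 < complex.Re (hform (T *m H) x x)) ->
  forall x, x != 0 -> complex.Re (hform H x x) < 0.
Proof.
elim: n => [|n IH] in T H *.
  by move=> _ _ _ _ x; rewrite thinmx0 eqxx.
move: T H; rewrite -[n.+1]/(1 + n)%N => T H hH trT Tneg Tpos.
have /is_trig_mxP tr0 := trT.
set e : 'rV[C]_(1 + n) := row_mx 1%:M 0.
set t := T 0 0; set c := dlsubmx T; set T2 := drsubmx T.
have TE : T = block_mx t%:M 0 c T2.
  rewrite -[LHS]submxK; congr block_mx.
    by apply/matrixP => i j; rewrite !ord1 !mxE eqxx mulr1n; congr (T _ _);
      apply/val_inj.
  apply/matrixP => i j; rewrite !mxE; apply: tr0.
  by rewrite /= ord1.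
have eT : e *m T = t *: e.
  by rewrite /e TE mul_row_block !mul0mx !mul1mx !addr0 scale_row_mx scaler0 scalemx1.
have e0 : e != 0.
  by rewrite row_mx_eq0 negb_and; apply/orP; left; rewrite -scalemx1 scale1r matrix_nonzero1.
set eta := hform H e e.
have etaR : eta = (complex.Re eta)%:C.
  by apply: real_of_conj; rewrite -hform_conj.
have etaN : complex.Re eta < 0.
  have := Tpos e e0; have -> : hform (T *m H) e e = t * eta.
    by rewrite /hform mulmxA eT -!scalemxAl mxE.
  rewrite etaR mulrC ReZ; have := Tneg 0; rewrite -/t => tN.
  by rewrite nmulr_lgt0.
have eta0 : eta != 0.
  by apply: contraTneq etaN => ->; rewrite /= ltxx.
set B : 'M[C]_(n, 1 + n) := row_mx 0 1%:M.
set p : 'cV[C]_n := - eta^-1 *: (B *m H *m adjmx e).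
(* p is chosen so that the rows of P are H-orthogonal to e. *)
set P : 'M[C]_(n, 1 + n) := B + p *m e.
have eHe : e *m H *m adjmx e = eta%:M.
  by apply/matrixP => i j; rewrite !ord1 [RHS]mxE eqxx mulr1n.
have PHe : P *m H *m adjmx e = 0.
  rewrite /P !mulmxDl -!mulmxA (mulmxA e) eHe mul_mx_scalar /p scalerA.
  by rewrite mulrN mulfV// scaleN1r !mulmxA subrr.
have eHP : e *m H *m adjmx P = 0.
  by rewrite -{1}hH -{1}(adjmxK e) -!adjmx_mul mulmxA PHe; apply/matrixP => i j; rewrite !mxE conjc0.
have PE : P = row_mx p 1%:M.
  by rewrite /P /B /e mul_mx_row mulmx1 mulmx0 add_row_mx add0r addr0.
have [w PT] : exists w, P *m T = T2 *m P + w *m e.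
  exists (t *: p + c - T2 *m p).
  rewrite PE TE mul_row_block (mul_mx_row T2) /e (mul_mx_row (_ + _)) add_row_mx.
  rewrite !mulmx1 !mulmx0 mul1mx add0r addr0 mul1mx; congr row_mx.
  by rewrite mul_mx_scalar addrC (addrC (T2 *m p)) subrK addrC.
set H2 := P *m H *m adjmx P.
have H2neg : forall y, y != 0 -> complex.Re (hform H2 y y) < 0.
  apply: (IH T2).
  - exact: adjmx_congr.
  - apply/is_trig_mxP => i j ij; rewrite !mxE.
    by apply: tr0; rewrite /= ltn_add2l.
  - by move=> i; rewrite !mxE; apply: Tneg.
  - move=> y y0; have -> : hform (T2 *m H2) y y = hform (T *m H) (y *m P) (y *m P).
      rewrite hform_mull /H2 !mulmxA PT !mulmxDl; congr (hform _ _ _).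
      by rewrite -!(mulmxA w) eHP mulmx0 addr0.
    apply: Tpos; apply: contra y0 => /eqP.
    by rewrite PE mul_mx_row mulmx1 => /eqP; rewrite row_mx_eq0 => /andP[].
move=> x x0; set y := rsubmx x; set s := lsubmx x - y *m p.
have xE : x = y *m P + s *m e.
  rewrite PE /e !mul_mx_row add_row_mx !mulmx1 mulmx0 addr0 addrC subrK.
  by rewrite hsubmxK.
have seE : s *m e = s 0 0 *: e by rewrite {1}[s]mx11_scalar mul_scalar_mx.
have He0 : hform H (y *m P) e = 0.
  by rewrite /hform -!mulmxA (mulmxA P) PHe mulmx0 mxE.
have xx : hform H x x = hform H2 y y + (cabs (s 0 0) ^+ 2)%:C * eta.
  rewrite xE seE hformDl !hformDr hform_mull !hformZl !hformZr.
  rewrite (hform_conj (y *m P)) // He0 conjc0 !mulr0 addr0 add0r mulrA.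
  by rewrite mul_conjc.
rewrite xx ReD ReZ; have [y0|/H2neg yN] := eqVneq y 0.
  have s0 : s 0 0 != 0.
    apply: contra x0 => /eqP s0; rewrite xE seE y0 s0 mul0mx scale0r addr0.
    exact: eqxx.
  rewrite y0 /hform !mul0mx mxE add0r pmulr_rlt0// exprn_gt0//.
  exact: cabs_gt0.
apply: ltr_wnDr => //; rewrite nmulr_lle0// sqr_ge0//.
Qed.

(** Lyapunov's theorem. A Schur decomposition of A, followed by the
    congruence of H by the same base change, reduces it to the triangular
    case. *)
Lemma lyapunov n (A H : 'M[C]_n) : adjmx H = H ->
  (forall mu, eigenvalue A mu -> complex.Re mu < 0) ->
  (forall x, x != 0 -> 0 < complex.Re (hform (A *m H) x x)) ->
  forall x, x != 0 -> complex.Re (hform H x x) < 0.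
Proof.
case: n A H => [|n] A H hH Aneg Apos x x0; first by rewrite thinmx0 eqxx in x0.
have [P Pu] := Schur A (ltn0Sn n); have uP := unitarymx_unit Pu.
set T := conjmx P A => trig0; have trig : is_trig_mx T by exact: trig0.
have TE : T *m P = P *m A by rewrite /T conjumx// mulmxKV.
have PK : x = x *m invmx P *m P by rewrite mulmxKV.
have y0 : x *m invmx P != 0.
  by apply: contra x0 => /eqP y0; rewrite PK y0 mul0mx.
rewrite PK hform_mull; apply: (lyapunov_trig _ trig) => // [|i|y yn0].
- exact: adjmx_congr.
- apply: Aneg; rewrite eigenvalue_root_min -(mxminpoly_uconj _ uP).
  rewrite root_mxminpoly -/T char_poly_trig// (bigD1 i)//= rootM.
  by rewrite root_XsubC eqxx.
rewrite !mulmxA TE -(mulmxA P) -hform_mull; apply: Apos.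
apply: contra yn0 => /eqP yP; rewrite -[y](mulmxK uP) yP mul0mx.
exact: eqxx.
Qed.

(** An eigenvector for a purely imaginary eigenvalue would contradict the
    positivity, since H is real on it; so the previous theorem applies to -
    A and - H. *)
Lemma lyapunov_pos n (A H : 'M[C]_n) : adjmx H = H ->
  (forall mu, eigenvalue A mu -> 0 <= complex.Re mu) ->
  (forall x, x != 0 -> 0 < complex.Re (hform (A *m H) x x)) ->
  forall x, x != 0 -> 0 < complex.Re (hform H x x).
Proof.
move=> hH Apos accr x x0.
have HN (M : 'M[C]_n) y : hform (- M) y y = - hform M y y.
  by rewrite /hform mulmxN mulNmx mxE.
rewrite -oppr_lt0 -ReN -HN; apply: (@lyapunov _ (- A)) x0 => [|mu|y /accr].
- by rewrite -{2}hH; apply/matrixP => i j; rewrite !mxE rmorphN.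
- move=> /eigenvalueP[v vA v0].
  have vmA : v *m A = - mu *: v by rewrite scaleNr -vA mulmxN opprK.
  have /Apos : eigenvalue A (- mu) by apply/eigenvalueP; exists v.
  rewrite ReN oppr_ge0 le_eqVlt => /orP[/eqP mu0|//].
  have := accr v v0; have -> : hform (A *m H) v v = - mu * hform H v v.
    by rewrite -hformZl /hform mulmxA vmA.
  rewrite (real_of_conj (esym (hform_conj v v hH))) mulrC ReZ ReN mu0.
  by rewrite oppr0 mulr0 ltxx.
- by rewrite mulNmx mulmxN opprK.
Qed.

Lemma accretive_sub p n (A H : 'M[C]_n) (U : 'M[C]_(p, n)) B :
  row_free U -> U *m A = B *m U ->
  (forall x, x != 0 -> 0 < complex.Re (hform (A *m H) x x)) ->
  forall x, x != 0 -> 0 < complex.Re (hform (B *m (U *m H *m adjmx U)) x x).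
Proof.
move=> fU UA accr x x0; rewrite !mulmxA -UA -(mulmxA U) -hform_mull.
apply: accr; apply: contra x0 => /eqP h.
by apply/eqP/(row_free_inj fU); rewrite h mul0mx.
Qed.

Lemma wide_kernel p n (A : 'M[C]_(p, n)) : (n < p)%N ->
  exists2 x : 'rV[C]_p, x != 0 & x *m A = 0.
Proof.
move=> np; have : kermx A != 0.
  rewrite kermx_eq0 /row_free neq_ltn; apply/orP; left.
  exact: leq_ltn_trans (rank_leq_col A) np.
by case/rowV0Pn => x /sub_kermxP xA x0; exists x.
Qed.

(** On an eigenvector for mu the matrix q(A) acts as q(mu). *)
Lemma stable_eigen n p (A : 'M[C]_n) (q : {poly C}) (U : 'M[C]_(p, n)) B mu :
  row_free U -> (U <= kermxpoly A q)%MS -> U *m A = B *m U ->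
  eigenvalue B mu -> root q mu.
Proof.
move=> fU Uq UA /eigenvalueP[x xB x0].
have xU0 : x *m U != 0.
  by apply: contra x0 => /eqP h; apply/eqP/(row_free_inj fU); rewrite h mul0mx.
have : (x *m U <= kermxpoly A q)%MS by rewrite (submx_trans _ Uq) ?submxMl.
have xA : x *m U *m A = mu *: (x *m U).
  by rewrite -mulmxA UA mulmxA xB scalemxAl.
case: n A U UA fU Uq xU0 xA => [|n] A U _ _ _ xU0 xA.
  by rewrite thinmx0 eqxx in xU0.
move/sub_kermxP; have -> : x *m U *m horner_mx A q = q.[mu] *: (x *m U).
  elim/poly_ind: q => [|q c IH].
    by rewrite rmorph0 mulmx0 horner0 scale0r.
  rewrite rmorphD rmorphM /= horner_mx_X horner_mx_C mulmxDr mulmxA IH.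
  rewrite -scalemxAl xA mul_mx_scalar scalerA -scalerDl hornerMXaddC.
  by [].
by move/eqP; rewrite scaler_eq0 (negPf xU0) orbF.
Qed.

(** Factor the characteristic polynomial according to the sign of the real
    parts of its roots. The kernels of the two factors evaluated at A are
    invariant, their dimensions add up to n because the factors are coprime
    (Cayley-Hamilton), and the two forms of Lyapunov's theorem give the sign
    of H on each. *)
Lemma invariant_split n (A H : 'M[C]_n) : adjmx H = H ->
  (forall x, x != 0 -> 0 < complex.Re (hform (A *m H) x x)) ->
  exists p q (U : 'M[C]_(p, n)) (V : 'M[C]_(q, n)) (B : 'M[C]_p),
  [/\ (p + q = n)%N, row_free U, U *m A = B *m U,
    forall x, x != 0 -> complex.Re (hform H (x *m U) (x *m U)) < 0 &
    forall x, x != 0 -> 0 < complex.Re (hform H (x *m V) (x *m V))].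
Proof.
move=> hH pos.
have [rs rsE] := closed_field_poly_normal (char_poly A).
rewrite (monicP (char_poly_monic A)) scale1r in rsE.
pose pr (b : bool) := \prod_(z <- rs | (complex.Re z < 0) == b) ('X - z%:P) : {poly C}.
have rpr b mu : root (pr b) mu -> (complex.Re mu < 0) = b.
  rewrite /pr -big_filter root_prod_XsubC mem_filter => /andP[/eqP -> _] //.
have cop : coprimep (pr true) (pr false).
  apply: Pdiv.ClosedField.root_coprimep => z /rpr zn.
  by apply/negP => /rpr; rewrite zn.
have prM : pr true * pr false = char_poly A.
  rewrite rsE (bigID (fun z => complex.Re z < 0)) /=; congr (_ * _).
    by apply: eq_bigl => z; rewrite eqb_id.
  by apply: eq_bigl => z; rewrite eqbF_neg.
have stable b : exists2 B, row_base (kermxpoly A (pr b)) *m A =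
      B *m row_base (kermxpoly A (pr b)) &
    forall mu, eigenvalue B mu -> (complex.Re mu < 0) = b.
  have fU := row_base_free (kermxpoly A (pr b)).
  have Uk : (row_base (kermxpoly A (pr b)) <= kermxpoly A (pr b))%MS.
    by rewrite eq_row_base.
  have UA : (row_base (kermxpoly A (pr b)) *m A <=
             row_base (kermxpoly A (pr b)))%MS.
    have := @comm_mx_stable_kermxpoly _ _ A A (pr b) erefl.
    by rewrite (eqmxMr _ (eq_row_base _)) !eq_row_base.
  exists (row_base (kermxpoly A (pr b)) *m A *m pinvmx (row_base (kermxpoly A (pr b)))).
    by rewrite mulmxKpV.
  move=> mu /(stable_eigen fU Uk _)/rpr -> //.
  by rewrite mulmxKpV.
have [B UA Bneg] := stable true; have [B' VA Bpos] := stable false.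
have fU b := row_base_free (kermxpoly A (pr b)).
exists _, _, (row_base (kermxpoly A (pr true))), (row_base (kermxpoly A (pr false))), B.
split; [| exact: (fU true) | exact: UA | |]; last 2 first.
- move=> x x0; rewrite hform_mull; move: x x0; apply: (@lyapunov _ B).
  + exact: adjmx_congr.
  + by move=> mu /Bneg.
  + exact: accretive_sub UA pos.
- move=> x x0; rewrite hform_mull; move: x x0; apply: (@lyapunov_pos _ B').
  + exact: adjmx_congr.
  + by move=> mu /Bpos /negbT; rewrite -leNgt.
  + exact: accretive_sub VA pos.
rewrite -(mxrank_disjoint_sum (mxdirect_kermxpoly A cop)) -(kermxpolyM A cop) prM.
case: n A {hH pos rs rsE pr rpr cop prM stable B UA Bneg B' VA Bpos H fU} => [|n] A.
  by apply/eqP; rewrite -leqn0 rank_leq_row.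
by rewrite (kermxpoly_min (mxminpoly_dvd_char A)) mxrank1.
Qed.
Lemma iter_mulmxr n (M : 'M[C]_n.+1) N (w : 'rV[C]_n.+1) :
  iter N (mulmx^~ M) w = w *m M ^+ N.
Proof.
by elim: N w => [|N IH] w; rewrite ?expr0 ?mulmx1// iterSr IH exprS -mulmxA.
Qed.

(** Every vector is a sum of generalised eigenvectors, in the form of an
    induction principle. One root of the characteristic polynomial is split
    off at a time: its full power is coprime to the remaining factor. *)
Lemma gen_eigen_ind n (S : 'M[C]_n) (P : 'rV[C]_n -> Prop) :
  P 0 -> (forall x y, P x -> P y -> P (x + y)) ->
  (forall (z : C) N x, iter N (fun y => y *m (S - z%:M)) x = 0 -> P x) ->
  forall x, P x.
Proof.
case: n S P => [|n] S P P0 PD Pz x; first by rewrite thinmx0.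
have [rs rsE] := closed_field_poly_normal (char_poly S).
rewrite (monicP (char_poly_monic S)) scale1r in rsE.
have : x *m horner_mx S (\prod_(z <- rs) ('X - z%:P)) = 0.
  by rewrite -rsE Cayley_Hamilton mulmx0.
elim: {rs rsE}(size rs) {-2}rs (leqnn (size rs)) x => [|k IH] [|z rs] //= rsk x.
- by rewrite big_nil rmorph1 mulmx1 => ->.
- by rewrite big_nil rmorph1 mulmx1 => ->.
set q := \prod_(y <- rs | y != z) ('X - y%:P).
have -> : \prod_(y <- z :: rs) ('X - y%:P) = ('X - z%:P) ^+ (count_mem z rs).+1 * q.
  rewrite big_cons (bigID (pred1 z)) /= mulrA exprS; congr (_ * _ * _).
  rewrite -big_filter (eq_big_seq (fun=> 'X - z%:P)); last first.
    by move=> y; rewrite mem_filter => /andP[/eqP -> _].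
  by rewrite big_const_seq count_predT size_filter -Monoid.iteropE.
set N := (count_mem z rs).+1 => xq.
have cop : coprimep (('X - z%:P) ^+ N) q.
  rewrite coprimep_expl// coprimep_sym coprimep_XsubC /q -big_filter.
  by rewrite root_prod_XsubC mem_filter eqxx.
have : (x <= kermxpoly S (('X - z%:P) ^+ N * q))%MS by apply/sub_kermxP.
rewrite kermxpolyM// => /sub_addsmxP[[u v] /= ->]; apply: PD; last first.
  apply: (IH [seq y <- rs | y != z]).
    by rewrite size_filter (leq_trans (count_size _ _)).
  by rewrite big_filter; apply/sub_kermxP/submxMl.
apply: (Pz z N); have /sub_kermxP : (u *m kermxpoly S (('X - z%:P) ^+ N) <=
  kermxpoly S (('X - z%:P) ^+ N))%MS by rewrite submxMl.
move: (u *m _) => w <-; rewrite rmorphXn rmorphB /= horner_mx_X horner_mx_C.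
exact: (iter_mulmxr (S - z%:M) N w).
Qed.

End Linear.

(** * Form perturbations of a diagonal operator *)

Section Forms.
Variable R : realType.
Local Notation C := R[i].
Implicit Types (f g : fourier R) (s t : seq int).

(** Cauchy-Schwarz without square roots: the hypothesis has the same shape
    as the conclusion, so that the inequality iterates over double sums. *)
Lemma sum_CS (I : Type) (s : seq I) (x u v : I -> R) :
  (forall i, 0 <= x i) -> (forall i, 0 <= u i) -> (forall i, 0 <= v i) ->
  (forall i, x i ^+ 2 <= u i * v i) ->
  (\sum_(i <- s) x i) ^+ 2 <= (\sum_(i <- s) u i) * (\sum_(i <- s) v i).
Proof.
move=> x0 u0 v0 xuv; elim: s => [|i s IH]; first by rewrite !big_nil expr0n mulr0.
rewrite !big_cons; set X := \sum_(j <- s) x j in IH *.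
set U := \sum_(j <- s) u j in IH *; set V := \sum_(j <- s) v j in IH *.
have X0 : 0 <= X by apply: sumr_ge0.
have U0 : 0 <= U by apply: sumr_ge0.
have V0 : 0 <= V by apply: sumr_ge0.
have mix : x i * X *+ 2 <= u i * V + U * v i.
  rewrite -(@ler_pXn2r _ 2) ?nnegrE ?mulrn_wge0 ?addr_ge0 ?mulr_ge0//.
  have h : x i ^+ 2 * X ^+ 2 <= (u i * v i) * (U * V).
    by apply: ler_pM; rewrite ?sqr_ge0.
  have := sqr_ge0 (u i * V - U * v i); nra.
by have := xuv i; nra.
Qed.

Lemma le_mul_sqrt (x e y : R) : 0 <= e -> x ^+ 2 <= e ^+ 2 * y ->
  x <= e * Num.sqrt y.
Proof.
move=> e0 h; apply: le_trans (ler_norm x) _.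
rewrite -sqrtr_sqr -(ger0_norm e0) -sqrtr_sqr -sqrtrM ?sqr_ge0//.
by rewrite ler_wsqrtr.
Qed.

(** Used to turn a sum of moduli of series into the modulus of one series. *)
Lemma phase_ex (z : C) : exists2 c : C, cabs c <= 1 & c * z = (cabs z)%:C.
Proof.
have [->|z0] := eqVneq z 0.
  by exists 0; rewrite ?cabs0 ?mulr0 ?ler01.
have z1 := cabs_gt0 z0; exists ((cabs z)^-1%:C * conjc z).
  by rewrite cabsM cabs_conj cabs_real ger0_norm ?invr_ge0 ?cabs_ge0// mulVf ?gt_eqF.
rewrite -mulrA (mulrC (conjc z)) mul_conjc -rmorphM /=; congr (_%:C).
by rewrite expr2 mulKf// gt_eqF.
Qed.

Definition energy_le (q : int -> R) f (A : R) :=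
  sum_le (fun k => q k * cabs (f k) ^+ 2) A.

Definition finite_energy (q : int -> R) f := exists A, energy_le q f A.

(** The Hilbert-Schmidt norm of the matrix with entries W (k - j) / sqrt (q
    k * q j), that is of the perturbation measured in the energy norm of q,
    is at most e. *)
Definition form_small (W : fourier R) (q : int -> R) (e : R) :=
  forall s t, uniq s -> uniq t ->
    \sum_(k <- s) \sum_(j <- t) cabs (W (k - j)) ^+ 2 / (q k * q j) <= e ^+ 2.

Lemma cabs_sqrD (z w : C) :
  cabs (z + w) ^+ 2 <= 2 * cabs z ^+ 2 + 2 * cabs w ^+ 2.
Proof.
have := cabsD z w; have := cabs_ge0 (z + w); have := cabs_ge0 z.
have := cabs_ge0 w; set a := cabs z; set b := cabs w; set c := cabs _.
by have := sqr_ge0 (a - b); nra.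
Qed.

Section FixedForm.
Variables (W : fourier R) (q : int -> R) (e : R).
Hypotheses (q0 : forall k, 0 < q k) (e0 : 0 <= e) (Wq : form_small W q e).

Lemma finite_energyD f g : finite_energy q f -> finite_energy q g ->
  finite_energy q (fun k => f k + g k).
Proof.
move=> [A fA] [B gB]; exists (2 * A + 2 * B) => s us.
have two : 0 <= 2 :> R by [].
apply: le_trans (sum_leD (sum_leZ two fA) (sum_leZ two gB) us).
apply: ler_sum => k _; have := cabs_sqrD (f k) (g k); have := q0 k.
set x := cabs (f k) ^+ 2; set y := cabs (g k) ^+ 2; nra.
Qed.

Lemma finite_energyZ f (c : C) : finite_energy q f ->
  finite_energy q (fun k => c * f k).
Proof.
move=> [A fA]; exists (cabs c ^+ 2 * A).
apply: sum_le_le (sum_leZ (sqr_ge0 _) fA) => k.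
by rewrite cabsM exprMn mulrCA.
Qed.

Lemma finite_energy0 : finite_energy q (fun=> 0).
Proof.
by exists 0 => s _; rewrite big1// => k _; rewrite cabs0 expr0n mulr0.
Qed.

Lemma finite_energy_lc (I : Type) (r : seq I) (c : I -> C) (F : I -> fourier R) :
  (forall i, finite_energy q (F i)) ->
  finite_energy q (fun k => \sum_(i <- r) c i * F i k).
Proof.
move=> hF; elim: r => [|i r [A IH]].
  have [A hA] := finite_energy0; exists A; apply: sum_le_le hA => k.
  by rewrite big_nil.
have [B hB] := finite_energyD (finite_energyZ (c i) (hF i)) (ex_intro _ A IH).
by exists B; apply: sum_le_le hB => k; rewrite big_cons.
Qed.

(** Cauchy-Schwarz in j for fixed k, then in k. *)
Lemma form_bound f g A B s t : uniq s -> uniq t ->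
  energy_le q f A -> energy_le q g B ->
  \sum_(k <- s) \sum_(j <- t) cabs (W (k - j)) * cabs (f j) * cabs (g k)
    <= e * Num.sqrt (A * B).
Proof.
move=> us ut fA gB; apply: le_mul_sqrt => //.
set X := \sum_(k <- s) _.
have qp k : 0 <= q k by apply: ltW.
pose u k j := cabs (W (k - j)) ^+ 2 / (q k * q j).
pose v k j := (q j * cabs (f j) ^+ 2) * (q k * cabs (g k) ^+ 2).
have u0 k j : 0 <= u k j by rewrite divr_ge0 ?sqr_ge0 ?mulr_ge0.
have v0 k j : 0 <= v k j.
  by rewrite /v; apply: mulr_ge0; apply: mulr_ge0; rewrite ?sqr_ge0.
apply: (@le_trans _ _ ((\sum_(k <- s) \sum_(j <- t) u k j) *
                       (\sum_(k <- s) \sum_(j <- t) v k j))).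
  apply: sum_CS => [k|k|k|k].
  - by apply: sumr_ge0 => j _; rewrite !mulr_ge0 ?cabs_ge0.
  - exact: sumr_ge0.
  - exact: sumr_ge0.
  apply: sum_CS => // j; rewrite ?mulr_ge0 ?cabs_ge0//.
  rewrite /u /v !exprMn; have := q0 k; have := q0 j => qj qk.
  rewrite le_eqVlt; apply/orP; left; apply/eqP.
  by field; rewrite !gt_eqF.
apply: ler_pM; [| |exact: Wq|]; try by apply: sumr_ge0 => k _; apply: sumr_ge0.
rewrite /v; under eq_bigr do rewrite -mulr_suml.
rewrite -mulr_sumr; apply: ler_pM.
- by apply: sumr_ge0 => j _; rewrite mulr_ge0 ?sqr_ge0.
- by apply: sumr_ge0 => j _; rewrite mulr_ge0 ?sqr_ge0.
- exact: fA.
- exact: gB.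
Qed.

(** Testing against a single mode turns bounds on the form into bounds on
    single coefficients. *)
Lemma delta_energy k : energy_le q (fun j => (j == k)%:R) (q k).
Proof.
move=> s us; rewrite (eq_bigr (fun j => if j == k then q k else 0)); last first.
  move=> j _; case: eqP => [->|_]; rewrite ?cabs0 ?expr0n ?mulr0//.
  by rewrite /cabs ComplexField.Normc.normc1 expr1n mulr1.
rewrite -big_mkcond /= -big_filter; have [ks|ks] := boolP (k \in s).
  by rewrite filter_pred1_uniq// big_seq1.
by rewrite big_filter big_hasC ?ltW// has_pred1.
Qed.

Lemma fmul_has_sum f k : finite_energy q f ->
  has_sum (fun j => W (k - j) * f j) (fmul W f k).
Proof.
move=> [A fA]; apply: (zsumP (M := e * Num.sqrt (A * q k))) => t ut.
have := form_bound (s := [:: k]) isT ut fA (delta_energy k).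
rewrite big_seq1; apply: le_trans; apply: ler_sum => j _.
by rewrite cabsM eqxx /cabs ComplexField.Normc.normc1 mulr1.
Qed.

(** For finitely many k, multiply the series fmul W f k by phases and add
    them: the sum of their moduli is the sum of one series, whose finite
    partial sums are controlled by [form_bound]. *)
Lemma fmul_form_bound f g A B : energy_le q f A -> energy_le q g B ->
  sum_le (fun k => cabs (fmul W f k) * cabs (g k)) (e * Num.sqrt (A * B)).
Proof.
move=> fA gB s us.
have fE : finite_energy q f by exists A.
pose c k := projT1 (cid2 (phase_ex (fmul W f k))).
have c1 k : cabs (c k) <= 1 by rewrite /c; case: cid2.
have cE k : c k * fmul W f k = (cabs (fmul W f k))%:C by rewrite /c; case: cid2.
have hs := has_sum_lc s (fun k => c k * (cabs (g k))%:C) (fun k => fmul_has_sum k fE).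
have := has_sum_cabs_le (M := e * Num.sqrt (A * B)) hs.
have -> : \sum_(k <- s) c k * (cabs (g k))%:C * fmul W f k =
    (\sum_(k <- s) cabs (fmul W f k) * cabs (g k))%:C.
  rewrite rmorph_sum; apply: eq_bigr => k _.
  by rewrite mulrAC cE -rmorphM.
rewrite cabs_real ger0_norm ?sumr_ge0// => [|k _]; last by rewrite mulr_ge0 ?cabs_ge0.
apply=> t ut; apply: le_trans (form_bound us ut fA gB).
rewrite exchange_big; apply: ler_sum => j _; apply: le_trans (cabs_sum _ _) _.
apply: ler_sum => k _; rewrite !cabsM cabs_real (ger0_norm (cabs_ge0 _)).
rewrite mulrC -!mulrA mulrC -!mulrA; have := c1 k; have := cabs_ge0 (c k).
have := mulr_ge0 (mulr_ge0 (cabs_ge0 (W (k - j))) (cabs_ge0 (f j))) (cabs_ge0 (g k)).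
by nra.
Qed.

Lemma fmul_bound f A k : energy_le q f A -> cabs (fmul W f k) <= e * Num.sqrt (A * q k).
Proof.
move=> fA; have := fmul_form_bound fA (delta_energy k) (s := [:: k]) isT.
by rewrite big_seq1 eqxx /cabs ComplexField.Normc.normc1 mulr1.
Qed.

Lemma fmul_lc (I : Type) (r : seq I) (c : I -> C) (F : I -> fourier R) k :
  (forall i, finite_energy q (F i)) ->
  fmul W (fun j => \sum_(i <- r) c i * F i j) k = \sum_(i <- r) c i * fmul W (F i) k.
Proof.
move=> hF; have hs := fmul_has_sum k (finite_energy_lc r c hF).
apply: (has_sum_uniq hs).
apply: eq_has_sum (has_sum_lc r c (fun i => fmul_has_sum k (hF i))) => j.
by rewrite mulr_sumr; apply: eq_bigr => i _; rewrite mulrCA.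
Qed.

Lemma energy_attained f : finite_energy q f -> exists2 A, energy_le q f A &
  forall eps, 0 < eps -> exists2 s0, uniq s0 &
    A - eps <= \sum_(k <- s0) q k * cabs (f k) ^+ 2.
Proof.
move=> [A fA]; apply: (sum_le_attained (M := A)) => // k.
by rewrite mulr_ge0 ?sqr_ge0// ltW.
Qed.

Lemma energy0P f : energy_le q f 0 -> forall k, f k = 0.
Proof.
move=> f0 k; have := sum_le_term k f0; rewrite pmulr_rle0// => h.
apply: cabs_eq0; apply/eqP; rewrite -sqrf_eq0 eq_le h sqr_ge0//.
Qed.

(** The eigenvalue equation gives q |f|^2 <= |fmul W f| |f| in each mode, so
    the energy A of f satisfies A <= e * A. *)
Lemma no_eigenvector (d : int -> R) (z : C) f : e < 1 ->
  (forall k, q k <= cabs ((d k)%:C - z)) -> finite_energy q f ->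
  (forall k, (d k)%:C * f k + fmul W f k = z * f k) -> forall k, f k = 0.
Proof.
move=> e1 qz fE fz; have [A fA hA] := energy_attained fE.
have A0 := sum_le_ge0 fA.
have AeA : A <= e * A.
  apply/ler_addgt0Pr => eps eps0; have [s us h] := hA _ eps0.
  rewrite -lerBlDr; apply: le_trans h _.
  have := fmul_form_bound fA fA us; rewrite -expr2 sqrtr_sqr ger0_norm//.
  apply: le_trans; apply: ler_sum => k _.
  have -> : fmul W f k = - (((d k)%:C - z) * f k).
    by rewrite -[LHS](addKr ((d k)%:C * f k)) fz; ring.
  rewrite cabsN cabsM -mulrA -expr2 ler_wpM2r ?sqr_ge0//.
have A00 : A = 0 by nra.
by apply: energy0P; rewrite -A00.
Qed.

(** The diagonal part contributes the full energy A because J (d - a) = q,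
    and the perturbation changes the sum by at most e * A. *)
Lemma accretive (d J : int -> R) (a : R) f (l : C) A :
  (forall k, J k * (d k - a) = q k) -> (forall k, `|J k| = 1) ->
  energy_le q f A -> (forall eps, 0 < eps -> exists2 s0, uniq s0 &
    A - eps <= \sum_(k <- s0) q k * cabs (f k) ^+ 2) ->
  has_sum (fun k => (J k)%:C *
    ((d k)%:C * f k + fmul W f k - a%:C * f k) * conjc (f k)) l ->
  (1 - e) * A <= complex.Re l.
Proof.
move=> Jq J1 fA hA hs; have A0 := sum_le_ge0 fA.
apply/ler_addgt0Pr => eps eps0; have [s0 us0 h] := hA _ eps0.
rewrite -lerBlDr; apply: (has_sum_Re_ge (s0 := s0) hs) => s us ss.
have qf0 k : 0 <= q k * cabs (f k) ^+ 2 by rewrite mulr_ge0 ?sqr_ge0// ltW.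
have h1 := le_trans h (sum_le_sub qf0 us0 us ss).
have := fmul_form_bound fA fA us; rewrite -expr2 sqrtr_sqr ger0_norm// => h2.
apply: (@le_trans _ _ (\sum_(k <- s) q k * cabs (f k) ^+ 2 -
    \sum_(k <- s) cabs (fmul W f k) * cabs (f k))); first by lra.
rewrite -sumrB; apply: ler_sum => k _.
have -> : (J k)%:C * ((d k)%:C * f k + fmul W f k - a%:C * f k) * conjc (f k) =
    (J k)%:C * ((d k)%:C - a%:C) * (f k * conjc (f k)) + (J k)%:C * fmul W f k * conjc (f k) by ring.
rewrite mul_conjc -rmorphB -!rmorphM /= ReD Jq [X in X + _]/= lerD2l.
have := Re_le_cabs ((J k)%:C * fmul W f k * conjc (f k)).
by rewrite !cabsM cabs_real J1 cabs_conj mul1r ler_norml => /andP[].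
Qed.

End FixedForm.
End Forms.

(** * Limits along an ultrafilter *)

Section UltraLimit.
Variables (R : realType) (U : set_system nat).
Hypothesis UU : UltraFilter U.
Local Notation C := R[i].

Local Instance U_proper : ProperFilter U := @ultra_proper _ _ UU.

(** Bounded sequences always converge in this sense, so infinitely many
    coefficients pass to the limit at once without extracting subsequences. *)
Definition utends (u : nat -> C) (l : C) :=
  forall eps : R, 0 < eps -> U [set n | cabs (u n - l) <= eps].

(** The limit is the supremum of the x such that x <= u n for almost all n;
    maximality of the filter bounds u from above near this supremum. *)
Lemma ultra_lim_real (u : nat -> R) M : (forall n, `|u n| <= M) ->
  exists l, forall eps, 0 < eps -> U [set n | `|u n - l| <= eps].
Proof.
move=> uM; set E := [set x | U [set n | x <= u n]].
have hE : has_sup E.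
  split.
    exists (- M); rewrite /E /=; apply: filterS filterT => n _ /=.
    by have := uM n; rewrite ler_norml => /andP[].
  exists M => x /filter_ex[n /= xn].
  by apply: le_trans xn _; apply: le_trans (ler_norm _) _.
exists (sup E) => eps eps0.
have [x xE xs] := sup_adherent eps0 hE.
have nE : ~ E (sup E + eps).
  by move=> h; have := ub_le_sup (proj2 hE) h; rewrite leNgt ltrDl eps0.
have [//|h] := @in_ultra_setVsetC _ _ [set n | sup E + eps <= u n] UU.
apply: filterS (filterI xE h) => n /= [xn /negP]; rewrite -ltNge => nE'.
by rewrite ler_distl; apply/andP; split; lra.
Qed.

Lemma utends_ex (u : nat -> C) M : (forall n, cabs (u n) <= M) ->
  exists l, utends u l.
Proof.
move=> uM.
have [x hx] := ultra_lim_real (fun n => le_trans (Re_le_cabs (u n)) (uM n)).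
have [y hy] := ultra_lim_real (fun n => le_trans (Im_le_cabs (u n)) (uM n)).
exists (x +i* y) => eps eps0; have e2 : 0 < eps / 2 by rewrite divr_gt0.
apply: filterS (filterI (hx _ e2) (hy _ e2)) => n /= [h1 h2].
apply: le_trans (cabs_le_ReIm _) _.
by rewrite ReD ImD ReN ImN /=; lra.
Qed.

Lemma utends_uniq u l l' : utends u l -> utends u l' -> l = l'.
Proof.
move=> ul ul'; apply/eqP; rewrite -subr_eq0; apply/negPn/negP => /cabs_gt0 d0.
have e0 : 0 < cabs (l - l') / 3 by rewrite divr_gt0.
have [n /= [h1 h2]] := filter_ex (filterI (ul _ e0) (ul' _ e0)).
have := cabsD (l - u n) (u n - l'); rewrite addrA subrK (cabs_distC l); lra.
Qed.

Lemma utends_cst l : utends (fun=> l) l.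
Proof.
move=> eps eps0; apply: filterS filterT => n _ /=.
by rewrite subrr cabs0 ltW.
Qed.

Lemma utends_near u v l : U [set n | u n = v n] -> utends u l -> utends v l.
Proof.
move=> uv ul eps /ul; move=> h; apply: filterS (filterI uv h) => n /= [<-] //.
Qed.

Lemma utendsD u v l l' : utends u l -> utends v l' ->
  utends (fun n => u n + v n) (l + l').
Proof.
move=> ul vl eps eps0; have e2 : 0 < eps / 2 by rewrite divr_gt0.
apply: filterS (filterI (ul _ e2) (vl _ e2)) => n /= [h1 h2].
by rewrite opprD addrACA; apply: le_trans (cabsD _ _) _; lra.
Qed.

Lemma utendsM u v l l' : utends u l -> utends v l' ->
  utends (fun n => u n * v n) (l * l').
Proof.
move=> ul vl eps eps0.
set m := cabs l + cabs l' + 1.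
have m0 : 0 < m by rewrite /m; have := cabs_ge0 l; have := cabs_ge0 l'; lra.
(* With m = |l| + |l'| + 1, errors below min (1, eps / m) in both factors give
   an error below eps in the product. *)
have d0 : 0 < Num.min 1 (eps / m) by rewrite lt_min ltr01 divr_gt0.
apply: filterS (filterI (ul _ d0) (vl _ d0)) => n /=.
rewrite !le_min => -[/andP[h1 h2] /andP[h3 h4]].
have -> : u n * v n - l * l' = (u n - l) * (v n - l') + l * (v n - l') + (u n - l) * l'.
  by ring.
apply: le_trans (cabsD _ _) _; apply: le_trans (lerD (cabsD _ _) (lexx _)) _.
rewrite !cabsM; move: h2 h4; rewrite !ler_pdivlMr// => h2 h4.
have := cabs_ge0 l; have := cabs_ge0 l'; have := cabs_ge0 (u n - l).
have := cabs_ge0 (v n - l'); move: h1 h2 h3 h4 m0; rewrite /m.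
set A := cabs (u n - l); set B := cabs (v n - l'); set c := cabs l; set c' := cabs l'.
move=> A1 Am B1 Bm m0 B0 A0 c'0 c0.
have h5 : A * m <= eps by []. have h6 : B * m <= eps by [].
have : m * (A * B + c * B + A * c') <= m * eps.
  have : A * B <= B by nra.
  have c1 : 0 <= 1 + c by lra.
  have := ler_wpM2r c1 h6; have := ler_wpM2r c'0 h5.
  have := mulr_ge0 (ltW m0) B0; rewrite -/m => *.
  have mE : m * eps = eps * c' + eps * (1 + c) by rewrite /m -/c -/c'; ring.
  have : m * (A * B) <= m * B by rewrite ler_pM2l.
  lra.
by rewrite ler_pM2l.
Qed.

Lemma utends_conj u l : utends u l -> utends (fun n => conjc (u n)) (conjc l).
Proof.
move=> ul eps /ul h; apply: filterS h => n /=.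
by rewrite -rmorphB cabs_conj.
Qed.

Lemma utends_sum (I : Type) (r : seq I) (u : I -> nat -> C) l :
  (forall i, utends (u i) (l i)) ->
  utends (fun n => \sum_(i <- r) u i n) (\sum_(i <- r) l i).
Proof.
move=> ul; elim: r => [|i r IH].
  rewrite big_nil; apply: utends_near (utends_cst 0).
  by apply: filterS filterT => n _ /=; rewrite big_nil.
rewrite big_cons; apply: utends_near (utendsD (ul i) IH).
by apply: filterS filterT => n _ /=; rewrite big_cons.
Qed.

Lemma utends_Re_le u l M : utends u l -> U [set n | complex.Re (u n) <= M] ->
  complex.Re l <= M.
Proof.
move=> ul uM; apply/ler_addgt0Pr => eps eps0.
have [n /= [h1 h2]] := filter_ex (filterI uM (ul _ eps0)).
have := le_trans (Re_le_cabs _) h2; rewrite ReD ReN ler_norml => /andP[? ?]; lra.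
Qed.

End UltraLimit.

(** * The indefinite form and invariant subspaces *)

Section Indefinite.
Variable R : realType.
Local Notation C := R[i].
Implicit Types (f g : fourier R) (s t : seq int).

Definition lcomb p (g : 'I_p -> fourier R) (x : 'rV[C]_p) : fourier R :=
  fun k => \sum_i x 0 i * g i k.

Lemma lcombD p (g : 'I_p -> fourier R) x y k :
  lcomb g (x + y) k = lcomb g x k + lcomb g y k.
Proof. by rewrite /lcomb -big_split; apply: eq_bigr => i _; rewrite mxE mulrDl. Qed.

Lemma lcombZ p (g : 'I_p -> fourier R) (c : C) x k :
  lcomb g (c *: x) k = c * lcomb g x k.
Proof. by rewrite /lcomb mulr_sumr; apply: eq_bigr => i _; rewrite mxE mulrA. Qed.

Lemma lcomb_mulmx p n (g : 'I_n -> fourier R) (x : 'rV[C]_p) (A : 'M[C]_(p, n)) k :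
  lcomb g (x *m A) k = lcomb (fun i => lcomb g (row i A)) x k.
Proof.
rewrite /lcomb; under eq_bigr do rewrite mxE mulr_suml.
rewrite exchange_big; apply: eq_bigr => i _; rewrite mulr_sumr.
by apply: eq_bigr => j _; rewrite mxE mulrA.
Qed.

Lemma lcomb_delta p (g : 'I_p -> fourier R) i k : lcomb g (delta_mx 0 i) k = g i k.
Proof.
rewrite /lcomb (bigD1 i)//= mxE !eqxx mul1r big1 ?addr0// => j ji.
by rewrite mxE eqxx (negPf ji) mul0r.
Qed.

Definition kdelta (c : int) : fourier R := fun k => (k == c)%:R.

(** The signature J of the indefinite form; E is the finite set of the modes
    with d k < a. *)
Definition sign_in (E : seq int) k : R := if k \in E then -1 else 1.

Definition perturbed (d : int -> R) (W f : fourier R) : fourier R :=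
  fun k => (d k)%:C * f k + fmul W f k.

Variables (W : fourier R) (d q : int -> R) (a e : R) (E : seq int).

Local Notation J := (sign_in E).
Local Notation L := (perturbed d W).

Hypotheses (uE : uniq E) (q0 : forall k, 0 < q k) (e0 : 0 <= e) (e1 : e < 1).
Hypothesis Wq : form_small W q e.
Hypothesis Jq : forall k, J k * (d k - a) = q k.
Let J1 k : `|J k| = 1.
Proof. by rewrite /sign_in; case: ifP; rewrite ?normrN normr1. Qed.

Lemma L_lcomb p (v : 'I_p -> fourier R) (A : 'M[C]_p) x k :
  (forall i, finite_energy q (v i)) ->
  (forall i k, L (v i) k = lcomb v (row i A) k) ->
  L (lcomb v x) k = lcomb v (x *m A) k.
Proof.
move=> vE vA; rewrite lcomb_mulmx /perturbed [fmul _ _ _](fmul_lc q0 e0 Wq)//.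
rewrite /lcomb mulr_sumr -big_split; apply: eq_bigr => i _ /=.
by rewrite mulrCA -mulrDr -[X in _ * X]/(L (v i) k) vA.
Qed.

Section Truncation.
Variable w : seq int.
Hypotheses (uw : uniq w) (Ew : {subset E <= w}).

Definition extend (x : 'rV[C]_(size w)) : fourier R :=
  lcomb (fun i => kdelta (nth 0 w i)) x.

Lemma extend_nth x (j : 'I_(size w)) : extend x (nth 0 w j) = x 0 j.
Proof.
rewrite /extend /lcomb (bigD1 j)//= /kdelta eqxx mulr1 big1 ?addr0// => i ij.
by rewrite nth_uniq// eq_sym (inj_eq val_inj) (negPf ij) mulr0.
Qed.

Lemma extend_out x k : k \notin w -> extend x k = 0.
Proof.
move=> kw; rewrite /extend /lcomb big1// => i _; rewrite /kdelta.
case: eqP => [kE|_]; last by rewrite mulr0.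
by rewrite kE mem_nth in kw.
Qed.

Lemma sum_nth (F : int -> C) :
  \sum_(k <- w) F k = \sum_(j < size w) F (nth 0 w j).
Proof. by rewrite (big_nth 0) big_mkord. Qed.

Lemma extend_energy x : finite_energy q (extend x).
Proof. by apply: finite_energy_lc => // i; exists (q (nth 0 w i)); apply: delta_energy. Qed.

Lemma fmul_kdelta c k : fmul W (kdelta c) k = W (k - c).
Proof.
have hE : finite_energy q (kdelta c) by exists (q c); apply: delta_energy.
apply: (has_sum_uniq (fmul_has_sum q0 e0 Wq k hE)).
have -> : W (k - c) = \sum_(j <- [:: c]) W (k - j) * kdelta c j.
  by rewrite big_seq1 /kdelta eqxx mulr1.
apply: has_sum_supp => // j; rewrite inE /kdelta => /negPf ->.
by rewrite mulr0.
Qed.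

(** The compression of L to the modes of w, acting on row vectors. *)
Definition truncation : 'M[C]_(size w) := \matrix_(i, j)
  ((d (nth 0 w i))%:C * (i == j)%:R + W (nth 0 w j - nth 0 w i)).

Lemma perturbed_extend x (j : 'I_(size w)) :
  L (extend x) (nth 0 w j) = (x *m truncation) 0 j.
Proof.
rewrite /perturbed extend_nth [fmul _ _ _](fmul_lc q0 e0 Wq); last first.
  by move=> i; exists (q (nth 0 w i)); apply: delta_energy.
rewrite mxE; under [RHS]eq_bigr do rewrite mxE mulrDr.
rewrite big_split /=; congr (_ + _).
  rewrite (bigD1 j)//= eqxx mulr1 big1 ?addr0 1?mulrC// => i /negPf ->.
  by rewrite !mulr0.
by apply: eq_bigr => i _; rewrite fmul_kdelta.
Qed.

Definition sign_mx : 'M[C]_(size w) := diag_mx (\row_j (J (nth 0 w j))%:C).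

Lemma hform_sign x y : hform sign_mx x y =
  \sum_(k <- w) (J k)%:C * extend x k * conjc (extend y k).
Proof.
rewrite sum_nth /hform mxE; apply: eq_bigr => j _.
rewrite !extend_nth !mxE (bigD1 j)//= !mxE eqxx mulr1n big1 ?addr0.
  by rewrite [X in X * _]mulrC.
by move=> i ij; rewrite !mxE (negPf ij) mulr0n mulr0.
Qed.

Lemma sign_mx_herm : adjmx sign_mx = sign_mx.
Proof.
apply/matrixP => i j; rewrite !mxE eq_sym; case: eqP => [->|_].
  by rewrite !mulr1n conjc_real.
by rewrite !mulr0n conjc0.
Qed.

Lemma hform_sign_Re x : complex.Re (hform sign_mx x x) =
  \sum_(k <- w) J k * cabs (extend x k) ^+ 2.
Proof.
rewrite hform_sign Re_sum; apply: eq_bigr => k _.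
by rewrite -mulrA mul_conjc ReZ.
Qed.

Lemma extend_nz x : x != 0 -> exists j : 'I_(size w), extend x (nth 0 w j) != 0.
Proof.
move=> x0; apply: contrapT => /forallNP h; move/eqP: x0; apply.
by apply/rowP => j; rewrite mxE -extend_nth; apply/eqP/negPn/negP/h.
Qed.

(** The extension of x by zero has finite energy, and the terms of the
    series in [accretive] vanish outside w, so accretivity of L restricts to
    its compression. *)
Lemma truncation_accretive x : x != 0 ->
  0 < complex.Re (hform ((truncation - a%:C%:M) *m sign_mx) x x).
Proof.
move=> x0; have fE := extend_energy x.
have [A1 fA hA] := energy_attained q0 fE.
have A0 : 0 < A1.
  rewrite lt_def (sum_le_ge0 fA) andbT.
  have [j] := extend_nz x0; apply: contra => /eqP A10.
  by rewrite A10 in fA; rewrite (energy0P q0 fA).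
apply: (@lt_le_trans _ _ ((1 - e) * A1)); first by rewrite mulr_gt0// subr_gt0.
apply: (accretive q0 e0 Wq Jq J1 fA hA).
have -> : hform ((truncation - a%:C%:M) *m sign_mx) x x =
    hform sign_mx (x *m (truncation - a%:C%:M)) x by rewrite /hform !mulmxA.
have -> : hform sign_mx (x *m (truncation - a%:C%:M)) x = \sum_(k <- w)
    (J k)%:C * ((d k)%:C * extend x k + fmul W (extend x) k - a%:C * extend x k) *
    conjc (extend x k).
  rewrite hform_sign !sum_nth; apply: eq_bigr => j _; congr (_ * _ * _).
  rewrite extend_nth mulmxBr mul_mx_scalar mxE -perturbed_extend !mxE.
  by rewrite extend_nth /perturbed extend_nth.
by apply: has_sum_supp => // k kw; rewrite (extend_out x kw) conjc0 mulr0.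
Qed.

(** Otherwise some nonzero combination of the rows of U would vanish at
    every mode of w satisfying P. *)
Lemma definite_size p (U : 'M[C]_(p, size w)) (P : pred int) :
  (forall x : 'rV_p, x != 0 -> (forall k, k \in w -> P k -> extend (x *m U) k = 0) -> False) ->
  (p <= count P w)%N.
Proof.
move=> hU; rewrite leqNgt; apply/negP => pP.
set s := seq.filter P w; have sp : (size s < p)%N by rewrite size_filter.
have [x x0 xE] := wide_kernel
  (\matrix_(i, j) extend (row i U) (nth 0 s j) : 'M[C]_(p, size s)) sp.
apply: (hU x x0) => k kw Pk; have ks : k \in s by rewrite mem_filter Pk.
have ks' : (index k s < size s)%N by rewrite index_mem.
have := congr1 (fun M : 'rV__ => M 0 (Ordinal ks')) xE.
rewrite !mxE => h; rewrite -[RHS]h /extend lcomb_mulmx /lcomb.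
by apply: eq_bigr => i _; rewrite mxE /= nth_index.
Qed.

(** The dimension of the negative space of [invariant_split] is forced: no
    nonzero vector of it vanishes on E, no nonzero vector of the
    complementary positive space vanishes off E, and the two dimensions add
    up to the number of modes. Hence evaluation at the modes of E is
    invertible on the negative space, and g is the basis dual to these
    evaluations. *)
Lemma galerkin_step : exists (g : 'I_(size E) -> fourier R) (S : 'M[C]_(size E)),
  [/\ forall i k, k \notin w -> g i k = 0,
      forall i j : 'I_(size E), g i (nth 0 E j) = (i == j)%:R,
      forall i k, k \in w -> L (g i) k = lcomb g (row i S) k &
      forall x, \sum_(k <- w) J k * cabs (lcomb g x k) ^+ 2 <= 0].
Proof.
have [p [p' [U [V [B [pp' fU UA Un Vp]]]]]] :=
  invariant_split sign_mx_herm truncation_accretive.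
have countE : count (mem E) w = size E.
  rewrite -size_filter; apply/perm_size/uniq_perm; rewrite ?filter_uniq// => k.
  by rewrite mem_filter /=; case kE : (k \in E) => //=; rewrite Ew.
have Uinj (x : 'rV_p) : x != 0 ->
    (forall k, k \in w -> k \in E -> extend (x *m U) k = 0) -> False.
  move=> x0 h; have := Un x x0; rewrite hform_sign_Re; apply/negP.
  rewrite -leNgt big_seq_cond; apply: sumr_ge0 => k; rewrite andbT => kw.
  rewrite /sign_in; case: ifP => kE; last by rewrite mul1r sqr_ge0.
  by rewrite h// cabs0 expr0n mulr0.
have pE : (p <= size E)%N by rewrite -countE; apply: (definite_size (U := U)).
have pE' : (p' <= size w - size E)%N.
  rewrite -countE -(count_predC (mem E) w) addKn.
  apply: (definite_size (U := V)) => x x0 h.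
  have := Vp x x0; rewrite hform_sign_Re; apply/negP.
  rewrite -leNgt big_seq_cond; apply: sumr_le0 => k; rewrite andbT => kw.
  rewrite /sign_in; case: ifP => kE; first by rewrite mulN1r oppr_le0 sqr_ge0.
  by rewrite h ?cabs0 ?expr0n ?mulr0//= kE.
have Ele : (size E <= size w)%N by apply: uniq_leq_size.
have {pE pE' pp'} pE : p = size E by lia.
move: U B fU UA Un Uinj; rewrite pE => U B fU UA Un Uinj {p pE p' V Vp}.
(* The matrix of the evaluations at the modes of E. *)
pose T : 'M[C]_(size E) := \matrix_(i, j) extend (row i U) (nth 0 E j).
have Text x k : extend (x *m U) k = lcomb (fun i => extend (row i U)) x k.
  by rewrite /extend lcomb_mulmx.
have uT : T \in unitmx.
  rewrite -row_free_unit -kermx_eq0; apply/negPn/negP => /rowV0Pn[x /sub_kermxP xT x0].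
  apply: (Uinj x x0) => k kw kE.
  have kE' : (index k E < size E)%N by rewrite index_mem.
  have := congr1 (fun M : 'rV__ => M 0 (Ordinal kE')) xT.
  rewrite !mxE => h; rewrite -[RHS]h Text /lcomb.
  by apply: eq_bigr => i _; rewrite mxE /= nth_index.
pose N := invmx T *m U; pose g i := extend (row i N).
pose S := invmx T *m B *m T + a%:C%:M.
have gx x k : lcomb g x k = extend (x *m N) k by rewrite /extend lcomb_mulmx.
have NM : N *m truncation = S *m N.
  rewrite /S mulmxDl mul_scalar_mx /N !mulmxA mulmxK// -(mulmxA _ B) -UA.
  by rewrite mulmxBr mulmxBr mul_mx_scalar -scalemxAr !mulmxA subrK.
exists g, S; split.
- by move=> i k kw; apply: extend_out.
- move=> i j; rewrite /g.
  have -> : row i N = row i (invmx T) *m U by rewrite row_mul.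
  rewrite Text /lcomb.
  have := congr1 (fun M : 'M[C]_(size E) => M i j) (mulVmx uT); rewrite !mxE => <-.
  by apply: eq_bigr => l _; rewrite !mxE.
- move=> i k kw; have kw' : (index k w < size w)%N by rewrite index_mem.
  rewrite gx -row_mul -NM row_mul.
  have := perturbed_extend (row i N) (Ordinal kw'); rewrite /= nth_index// => ->.
  by rewrite -extend_nth /= nth_index.
- move=> x; under eq_bigr do rewrite gx.
  rewrite -hform_sign_Re /N mulmxA.
  have [->|xT0] := eqVneq (x *m invmx T) 0.
    by rewrite mul0mx /hform !mul0mx mxE.
  by apply/ltW/Un.
Qed.

End Truncation.

Section TruncationBounds.
Variables (w : seq int) (g : 'I_(size E) -> fourier R) (S : 'M[C]_(size E)).
Hypotheses (uw : uniq w) (Ew : {subset E <= w}).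
Hypothesis g_out : forall i k, k \notin w -> g i k = 0.
Hypothesis gE : forall i j : 'I_(size E), g i (nth 0 E j) = (i == j)%:R.
Hypothesis gS : forall i k, k \in w -> L (g i) k = lcomb g (row i S) k.
Hypothesis g_neg : forall x, \sum_(k <- w) J k * cabs (lcomb g x k) ^+ 2 <= 0.

(** By negativity the part of g i off E is dominated by its part on E, which
    is a single coefficient 1. *)
Lemma truncation_norm i : \sum_(k <- w) cabs (g i k) ^+ 2 <= 2.
Proof.
have := g_neg (delta_mx 0 i); under eq_bigr do rewrite lcomb_delta.
move=> h; have -> : \sum_(k <- w) cabs (g i k) ^+ 2 =
    \sum_(k <- w) J k * cabs (g i k) ^+ 2 +
    2 * \sum_(k <- w | k \in E) cabs (g i k) ^+ 2.
  rewrite [X in 2 * X]big_mkcond mulr_sumr -big_split; apply: eq_bigr => k _ /=.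
  by rewrite /sign_in; case: ifP => _; ring.
suff -> : \sum_(k <- w | k \in E) cabs (g i k) ^+ 2 = 1 by lra.
rewrite -big_filter (perm_big E); last first.
  apply/uniq_perm; rewrite ?filter_uniq// => k.
  by rewrite mem_filter /=; case kE : (k \in E) => //=; rewrite Ew.
rewrite (big_nth 0) big_mkord (bigD1 i)//= gE eqxx big1 ?addr0.
  by rewrite /cabs ComplexField.Normc.normc1 expr1n.
by move=> j ji; rewrite gE eq_sym (negPf ji) cabs0 expr0n.
Qed.

(** The dual basis reads off the matrix of L from values of L (g i). *)
Lemma truncation_coef i j : S i j = L (g i) (nth 0 E j).
Proof.
rewrite gS ?Ew ?mem_nth// /lcomb (bigD1 j)//= gE eqxx mulr1 mxE big1 ?addr0//.
by move=> l lj; rewrite gE (negPf lj) mulr0.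
Qed.

Let D := \sum_(k <- E) `|d k|.
Let Q := \sum_(k <- E) Num.sqrt (q k).

Lemma truncation_coef_bound i j A : energy_le q (g i) A ->
  cabs (S i j) <= D + Q * Num.sqrt A.
Proof.
move=> gA; rewrite truncation_coef.
have EE : nth 0 E j \in E by apply: mem_nth.
apply: le_trans (cabsD _ _) _; apply: lerD.
  rewrite cabsM cabs_real gE; apply: (@le_trans _ _ `|d (nth 0 E j)|).
    rewrite ler_piMr//; case: eqP => _; last by rewrite cabs0 ler01.
    by rewrite /cabs ComplexField.Normc.normc1.
  rewrite /D (big_rem _ EE) /= lerDl; exact: sumr_ge0.
apply: le_trans (fmul_bound q0 e0 Wq _ gA) _.
rewrite sqrtrM ?(sum_le_ge0 gA)//.
apply: (@le_trans _ _ (Num.sqrt A * Num.sqrt (q (nth 0 E j)))).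
  by rewrite ler_piMl ?mulr_ge0 ?sqrtr_ge0// ltW.
rewrite mulrC ler_wpM2r ?sqrtr_ge0// /Q (big_rem _ EE) /= lerDl.
by apply: sumr_ge0 => k _; apply: sqrtr_ge0.
Qed.

Let b := 2 * ((size E)%:R * D + `|a|).
Let c := 2 * ((size E)%:R * Q).
(* If (1 - e) A <= b + c sqrt A, then sqrt A <= y: either sqrt A <= 1, or
   divide by sqrt A. *)
Let y := (b + c) / (1 - e) + 1.

(** An energy bound that does not depend on w. By accretivity (1 - e) A is
    at most 2 (sum_j |S i j| + |a|), and S i j grows at most like sqrt A; so
    A is bounded by an affine function of its square root. *)
Lemma truncation_energy i : energy_le q (g i) (y ^+ 2).
Proof.
have gEn : finite_energy q (g i).
  exists (\sum_(k <- w) q k * cabs (g i k) ^+ 2) => s us.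
  rewrite (bigID (mem w)) /= [X in _ + X]big1 ?addr0.
    rewrite -big_filter; apply: sum_le_sub => [k|||k]; rewrite ?filter_uniq//.
      by rewrite mulr_ge0 ?sqr_ge0// ltW.
    by rewrite mem_filter => /andP[].
  by move=> k /g_out ->; rewrite cabs0 expr0n mulr0.
have [A gA hA] := energy_attained q0 gEn.
have A0 := sum_le_ge0 gA.
suff Ay : A <= y ^+ 2 by move=> s us; apply: le_trans Ay; apply: gA.
have sA : Num.sqrt A ^+ 2 = A by rewrite sqr_sqrtr.
have supp k : k \notin w -> (J k)%:C *
    ((d k)%:C * g i k + fmul W (g i) k - a%:C * g i k) * conjc (g i k) = 0.
  by move=> /g_out ->; rewrite conjc0 mulr0.
have acc := accretive q0 e0 Wq Jq J1 gA hA (has_sum_supp uw supp).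
have pairs j : \sum_(k <- w) cabs (g j k) * cabs (g i k) <= 2.
  have := truncation_norm i; have := truncation_norm j => h1 h2.
  apply: (@le_trans _ _ (\sum_(k <- w) 2^-1 * (cabs (g j k) ^+ 2 + cabs (g i k) ^+ 2))).
    by apply: ler_sum => k _; have := sqr_ge0 (cabs (g j k) - cabs (g i k)); nra.
  by rewrite -mulr_sumr big_split /=; lra.
have main : (1 - e) * A <= b + c * Num.sqrt A.
  apply: (le_trans acc); apply: (le_trans (ler_norm _)).
  apply: (le_trans (Re_le_cabs _)); apply: (le_trans (cabs_sum _ _)).
  apply: (@le_trans _ _ (\sum_j cabs (S i j) * \sum_(k <- w) cabs (g j k) * cabs (g i k) +
     `|a| * \sum_(k <- w) cabs (g i k) * cabs (g i k))).
    under [X in _ <= X + _]eq_bigr do rewrite mulr_sumr.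
    rewrite exchange_big mulr_sumr -big_split /= big_seq [X in _ <= X]big_seq.
    apply: ler_sum => k kw; rewrite !cabsM cabs_real J1 mul1r cabs_conj.
    rewrite -[X in cabs (X - _)]/(L (g i) k) gS//.
    apply: (@le_trans _ _ ((\sum_j cabs (S i j) * cabs (g j k) + `|a| * cabs (g i k)) * cabs (g i k))).
      apply: ler_wpM2r; rewrite ?cabs_ge0//; apply: le_trans (cabsB _ _) _.
      rewrite cabsM cabs_real lerD2r; apply: le_trans (cabs_sum _ _) _.
      by apply: ler_sum => j _; rewrite mxE cabsM.
    rewrite mulrDl mulr_suml mulrA lerD2r; apply: ler_sum => j _.
    by rewrite mulrA.
  apply: (@le_trans _ _ (\sum_(j < size E) (D + Q * Num.sqrt A) * 2 + `|a| * 2)).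
    apply: lerD; last by rewrite ler_wpM2l ?pairs.
    apply: ler_sum => j _; apply: ler_pM; rewrite ?cabs_ge0 ?truncation_coef_bound//.
    by apply: sumr_ge0 => k _; rewrite mulr_ge0 ?cabs_ge0.
  rewrite sumr_const card_ord -mulr_natr /b /c; lra.
have D0 : 0 <= D by apply: sumr_ge0.
have Q0 : 0 <= Q by apply: sumr_ge0 => k _; apply: sqrtr_ge0.
have b0 : 0 <= b by rewrite /b mulr_ge0// addr_ge0// mulr_ge0.
have cc0 : 0 <= c by rewrite /c mulr_ge0// mulr_ge0.
have e1' : 0 < 1 - e by rewrite subr_gt0.
have z0 : 0 <= (b + c) / (1 - e) := divr_ge0 (addr_ge0 b0 cc0) (ltW e1').
have y0 : 0 <= y by rewrite /y addr_ge0.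
have s00 : 0 <= Num.sqrt A := sqrtr_ge0 A.
suff sy : Num.sqrt A <= y by rewrite -sA ler_pXn2r.
rewrite /y; have [s1|s1] := lerP (Num.sqrt A) 1; first lra.
suff : Num.sqrt A <= (b + c) / (1 - e) by lra.
rewrite ler_pdivlMr//; move: main; rewrite -{1}sA => main.
have s0 : 0 < Num.sqrt A by apply: lt_trans s1.
by rewrite -(ler_pM2r s0); nra.
Qed.

End TruncationBounds.

(** The tails of the series fmul W h k are small uniformly on energy balls.
    Hence fmul W at k is continuous for pointwise convergence with bounded
    energy. *)
Lemma fmul_tail k A eps : 0 < eps -> exists s0, forall h, energy_le q h A ->
  cabs (fmul W h k) <= \sum_(j <- s0) cabs (W (k - j)) * cabs (h j) + eps.
Proof.
move=> eps0; pose u j := cabs (W (k - j)) ^+ 2 / (q k * q j).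
have u0 j : 0 <= u j by rewrite divr_ge0 ?sqr_ge0// mulr_ge0 ?ltW.
have uM : sum_le u (e ^+ 2).
  by move=> t ut; have := Wq (s := [:: k]) isT ut; rewrite big_seq1.
have [B uB hB] := sum_le_attained u0 uM.
have A1 : 0 < `|A| + 1 by rewrite ltr_wpDl.
pose eta := eps ^+ 2 / (q k * (`|A| + 1)).
have eta0 : 0 < eta by rewrite divr_gt0 ?exprn_gt0// mulr_gt0.
have [s0 us0 hs0] := hB eta eta0; exists s0 => h hA.
have hE : finite_energy q h by exists A.
have A0 := sum_le_ge0 hA.
apply: (has_sum_cabs_le (fmul_has_sum q0 e0 Wq k hE)) => t ut.
rewrite (bigID (mem s0)) /=; apply: lerD.
  rewrite -big_filter; under eq_bigr do rewrite cabsM.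
  apply: sum_le_sub => [j|||j]; rewrite ?filter_uniq// ?mulr_ge0 ?cabs_ge0//.
  by rewrite mem_filter => /andP[].
rewrite -big_filter; set t' := seq.filter _ t.
have ut' : uniq t' by rewrite filter_uniq.
have tail : \sum_(j <- t') u j <= eta.
  have us : uniq (s0 ++ t').
    rewrite cat_uniq us0 ut' andbT; apply/hasPn => j.
    by rewrite mem_filter => /andP[].
  by have := uB _ us; rewrite big_cat /=; lra.
have := @sum_CS _ _ t' (fun j => cabs (W (k - j) * h j)) (fun j => q k * u j)
  (fun j => q j * cabs (h j) ^+ 2).
move=> /(_ (fun=> cabs_ge0 _)) H.
have S0 : 0 <= \sum_(j <- t') cabs (W (k - j) * h j).
  by apply: sumr_ge0 => j _; apply: cabs_ge0.
rewrite -(@ler_pXn2r _ 2) ?nnegrE ?(ltW eps0)//.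
apply: le_trans (H _ _ _) _ => [j|j|j|].
- by rewrite mulr_ge0// ltW.
- by rewrite mulr_ge0 ?sqr_ge0// ltW.
- rewrite cabsM exprMn /u le_eqVlt; apply/orP; left; apply/eqP.
  have := q0 k; have := q0 j => qj qk.
  by field; rewrite !gt_eqF.
have -> : eps ^+ 2 = q k * eta * (`|A| + 1).
  rewrite /eta; have qk := q0 k; field.
  by rewrite !gt_eqF.
apply: ler_pM.
- by apply: sumr_ge0 => j _; rewrite mulr_ge0// ltW.
- by apply: sumr_ge0 => j _; rewrite mulr_ge0 ?sqr_ge0// ltW.
- by rewrite -mulr_sumr ler_wpM2l// ltW.
- by apply: le_trans (hA _ ut') _; rewrite ger0_norm// lerDl.
Qed.

Definition window (N : nat) : seq int :=
  undup (E ++ [seq i%:Z - N%:Z | i <- iota 0 (N + N).+1]).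

Lemma window_uniq N : uniq (window N).
Proof. exact: undup_uniq. Qed.

Lemma window_E N : {subset E <= window N}.
Proof. by move=> k kE; rewrite mem_undup mem_cat kE. Qed.

Lemma window_mem N (k : int) : (`|k| <= N)%N -> k \in window N.
Proof.
move=> kN; rewrite mem_undup mem_cat; apply/orP; right.
apply/mapP; exists (absz (k + N%:Z)); last by lia.
by rewrite mem_iota; lia.
Qed.

Lemma window_sub s : exists N0, forall N, (N0 <= N)%N -> {subset s <= window N}.
Proof.
exists (\sum_(k <- s) `|k|)%N => N sN k ks; apply: window_mem.
by apply: leq_trans sN; rewrite (big_rem _ ks) /= leq_addr.
Qed.

(** Limit of the truncated dual bases over growing windows. The uniform
    energy bound gives finite energy of the limit and, with [fmul_tail],
    convergence of L in each mode; the sign of the form passes to the limit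
    on finite sets of modes, because the modes off E only increase it. *)
Lemma invariant_family : exists (g : 'I_(size E) -> fourier R) (S : 'M[C]_(size E)),
  [/\ forall i, finite_energy q (g i),
      forall i j : 'I_(size E), g i (nth 0 E j) = (i == j)%:R,
      forall i k, L (g i) k = lcomb g (row i S) k &
      forall x s, uniq s -> {subset E <= s} ->
        \sum_(k <- s) J k * cabs (lcomb g x k) ^+ 2 <= 0].
Proof.
have /choice[gS hgS] : forall N, exists gS : ('I_(size E) -> fourier R) * 'M[C]_(size E),
  [/\ forall i k, k \notin window N -> gS.1 i k = 0,
      forall i j : 'I_(size E), gS.1 i (nth 0 E j) = (i == j)%:R,
      forall i k, k \in window N -> L (gS.1 i) k = lcomb gS.1 (row i gS.2) k &
      forall x, \sum_(k <- window N) J k * cabs (lcomb gS.1 x k) ^+ 2 <= 0].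
  move=> N; have [g [S h]] := galerkin_step (window_uniq N) (@window_E N).
  by exists (g, S).
pose g N := (gS N).1; pose S N := (gS N).2.
have [U [UU leU]] := ultraFilterLemma (eventually_filter : ProperFilter (\oo : set_system nat)).
have UN N0 : U [set N | (N0 <= N)%N] by apply: leU; apply: nbhs_infty_ge.
pose y := (2 * ((size E)%:R * (\sum_(k <- E) `|d k|) + `|a|) +
  2 * ((size E)%:R * (\sum_(k <- E) Num.sqrt (q k)))) / (1 - e) + 1.
have gX N i : energy_le q (g N i) (y ^+ 2).
  have [h1 h2 h3 h4] := hgS N.
  exact: (truncation_energy (window_uniq N) (@window_E N) h1 h2 h3 h4).
have gEN N (i j : 'I_(size E)) : g N i (nth 0 E j) = (i == j)%:R.
  by have [_ h _ _] := hgS N; rewrite -h.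
have /choice [G0 hG0] : forall p : 'I_(size E) * int,
    exists l, utends U (fun N => g N p.1 p.2) l.
  move=> [i k]; apply: (@utends_ex _ _ UU _ (y ^+ 2 / q k + 1)) => N /=.
  have := sum_le_term k (gX N i); rewrite mulrC -ler_pdivlMr// => h.
  by have := sqr_ge0 (cabs (g N i k) - 1); nra.
pose G i k := G0 (i, k).
have hG i k : utends U (fun N => g N i k) (G i k) by apply: (hG0 (i, k)).
have /choice [M0 hM0] : forall p : 'I_(size E) * 'I_(size E),
    exists l, utends U (fun N => S N p.1 p.2) l.
  move=> [i j]; have [h1 h2 h3 h4] := hgS 0.
  apply: (@utends_ex _ _ UU _ (\sum_(k <- E) `|d k| +
    (\sum_(k <- E) Num.sqrt (q k)) * Num.sqrt (y ^+ 2))) => N /=.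
  have {h1 h2 h3 h4} [h1 h2 h3 h4] := hgS N.
  exact: (truncation_coef_bound (@window_E N) h2 h3 j (gX N i)).
pose M : 'M[C]_(size E) := \matrix_(i, j) M0 (i, j).
have hM i j : utends U (fun N => S N i j) (M i j) by rewrite mxE; apply: (hM0 (i, j)).
have hl x k : utends U (fun N => lcomb (g N) x k) (lcomb G x k).
  by apply: utends_sum => i; apply: utendsM => //; apply: utends_cst.
have hq (p : int -> R) x s B N0 : (forall N, (N0 <= N)%N ->
    \sum_(k <- s) p k * cabs (lcomb (g N) x k) ^+ 2 <= B) ->
    \sum_(k <- s) p k * cabs (lcomb G x k) ^+ 2 <= B.
  have ReE (f : fourier R) : \sum_(k <- s) p k * cabs (f k) ^+ 2 =
      complex.Re (\sum_(k <- s) (p k)%:C * (f k * conjc (f k))).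
    by rewrite Re_sum; apply: eq_bigr => k _; rewrite mul_conjc ReZ.
  move=> h; rewrite ReE; apply: (@utends_Re_le _ _ UU (fun N =>
    \sum_(k <- s) (p k)%:C * (lcomb (g N) x k * conjc (lcomb (g N) x k)))).
    apply: utends_sum => k; apply: utendsM; first exact: utends_cst.
    by apply: utendsM => //; apply: utends_conj.
  by apply: (@filterS _ _ (@ultra_proper _ _ UU)) (UN N0) => N /= /h; rewrite ReE.
have GX i : energy_le q (G i) (y ^+ 2).
  move=> s us; rewrite (eq_bigr (fun k => q k *
    cabs (lcomb G (delta_mx 0 i) k) ^+ 2)) => [|k _]; last by rewrite lcomb_delta.
  apply: (hq _ _ _ _ 0%N) => N _; under eq_bigr do rewrite lcomb_delta.
  exact: gX.
have GEn i : finite_energy q (G i) by exists (y ^+ 2).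
have gEn N i : finite_energy q (g N i) by exists (y ^+ 2).
exists G, M; split=> // [i j|i k|x s us Es].
- apply: (utends_uniq UU (hG i _)); apply: utends_near (utends_cst UU _).
  by apply: (@filterS _ _ (@ultra_proper _ _ UU)) (UN 0%N) => N _ /=; rewrite gEN.
- have hL : utends U (fun N => L (g N i) k) (L (G i) k).
    apply: utendsD; first by apply: utendsM => //; apply: utends_cst.
    move=> eps eps0; have e2 : 0 < eps / 2 by rewrite divr_gt0.
    have [s0 hs0] := fmul_tail k (2 * y ^+ 2 + 2 * y ^+ 2) e2.
    set T := \sum_(j <- s0) cabs (W (k - j)).
    have T0 : 0 <= T by apply: sumr_ge0 => j _; apply: cabs_ge0.
    have eta0 : 0 < eps / 2 / (T + 1) by rewrite divr_gt0// ltr_wpDl.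
    have hU : U [set N | forall j, j \in s0 ->
        cabs (g N i j - G i j) <= eps / 2 / (T + 1)].
      elim: (s0) => [|j s' IH].
        by apply: (@filterS _ _ (@ultra_proper _ _ UU)) (UN 0%N).
      apply: (@filterS _ _ (@ultra_proper _ _ UU)) (filterI IH (hG i j _ eta0)).
      move=> N /= [h1 h2] l; rewrite inE => /orP[/eqP -> //|].
      exact: h1.
    apply: (@filterS _ _ (@ultra_proper _ _ UU)) hU => N hN.
    suff: cabs (fmul W (g N i) k - fmul W (G i) k) <= eps by [].
    pose h j := g N i j + -1 * G i j.
    have hh : energy_le q h (2 * y ^+ 2 + 2 * y ^+ 2).
      move=> s us; apply: (@le_trans _ _ (\sum_(j <- s)
         (2 * (q j * cabs (g N i j) ^+ 2) + 2 * (q j * cabs (G i j) ^+ 2)))).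
        apply: ler_sum => j _; have := cabs_sqrD (g N i j) (-1 * G i j).
        rewrite {2}mulN1r cabsN -/(h j) => H.
        apply: le_trans (ler_wpM2l (ltW (q0 j)) H) _.
        by rewrite mulrDr !(mulrCA (q j) 2).
      rewrite big_split /= -!mulr_sumr; have := gX N i _ us; have := GX i _ us.
      lra.
    have -> : fmul W (g N i) k - fmul W (G i) k = fmul W h k.
      have fh : finite_energy q h by eexists; apply: hh.
      apply: has_sum_uniq (fmul_has_sum q0 e0 Wq k fh).
      rewrite -[- fmul _ _ _]mulN1r.
      apply: eq_has_sum (has_sumD (fmul_has_sum q0 e0 Wq k (gEn N i))
         (has_sumZ (-1) (fmul_has_sum q0 e0 Wq k (GEn i)))) => j.
      by rewrite /h; ring.
    apply: le_trans (hs0 _ hh) _.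
    suff : \sum_(j <- s0) cabs (W (k - j)) * cabs (h j) <= eps / 2 by lra.
    apply: (@le_trans _ _ (T * (eps / 2 / (T + 1)))).
      rewrite mulr_suml big_seq [X in _ <= X]big_seq; apply: ler_sum => j /hN.
      by rewrite /h mulN1r => ?; rewrite ler_wpM2l ?cabs_ge0.
    have TT : 0 < T + 1 by rewrite ltr_wpDl.
    by rewrite mulrCA ler_piMr ?ltW// ltr_pdivrMr// mul1r ltrDl.
  apply: (utends_uniq UU hL); apply: (utends_near UU _ (_ : utends U
      (fun N => lcomb (g N) (row i (S N)) k) _)).
    apply: (@filterS _ _ (@ultra_proper _ _ UU)) (UN `|k|%N) => N /= kN.
    by have [_ _ -> //] := hgS N; apply: window_mem.
  apply: utends_sum => j; apply: utendsM => //.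
  rewrite mxE; apply: utends_near (hM i j) => //.
  by apply: (@filterS _ _ (@ultra_proper _ _ UU)) (UN 0%N) => N _ /=; rewrite mxE.
- have [N0 sN] := window_sub s; apply: (hq _ _ _ _ N0) => N /sN sw.
  have [_ _ _ neg] := hgS N; apply: le_trans (neg x).
  rewrite [X in _ <= X](bigID (mem s)) /= -[X in _ <= X + _]big_filter.
  rewrite [X in _ <= X + _](perm_big s) /=; last first.
    apply/uniq_perm; rewrite ?filter_uniq ?window_uniq// => k.
    by rewrite mem_filter /=; case ks : (k \in s) => //=; rewrite sw.
  rewrite lerDl; apply: sumr_ge0 => k ks; rewrite /sign_in ifF ?mul1r ?sqr_ge0//.
  by apply: contraNF ks; apply: Es.
Qed.

Variable c0 : R.
Hypotheses (c00 : 0 < c0) (qc0 : forall k, c0 <= q k).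

Definition gram p (v : 'I_p -> fourier R) : 'M[C]_p :=
  \matrix_(i, j) zsum (fun k => (J k)%:C * v i k * conjc (v j k)).

(** The lower bound c0 on q makes finite energy imply square summability. *)
Lemma pair_has_sum f g : finite_energy q f -> finite_energy q g ->
  has_sum (fun k => (J k)%:C * f k * conjc (g k))
    (zsum (fun k => (J k)%:C * f k * conjc (g k))).
Proof.
move=> [A fA] [B gB]; apply: (zsumP (M := c0^-1 * (A + B))).
apply: sum_le_le (sum_leZ _ (sum_leD fA gB)) => [k|]; last by rewrite invr_ge0 ltW.
rewrite !cabsM cabs_real J1 mul1r cabs_conj -mulrDr mulrA.
have h : 1 <= c0^-1 * q k by rewrite mulrC ler_pdivlMr// mul1r.
have := sqr_ge0 (cabs (f k) - cabs (g k)).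
by have := sqr_ge0 (cabs (f k)); have := sqr_ge0 (cabs (g k)); nra.
Qed.

Lemma gram_has_sum p (v : 'I_p -> fourier R) x y :
  (forall i, finite_energy q (v i)) ->
  has_sum (fun k => (J k)%:C * lcomb v x k * conjc (lcomb v y k))
    (hform (gram v) x y).
Proof.
move=> vE.
have -> : hform (gram v) x y =
    \sum_j conjc (y 0 j) * \sum_i x 0 i * gram v i j.
  rewrite /hform mxE; apply: eq_bigr => j _; rewrite !mxE mulrC.
  by congr (_ * _).
have h1 j : has_sum (fun k => \sum_i x 0 i * ((J k)%:C * v i k * conjc (v j k)))
    (\sum_i x 0 i * gram v i j).
  by apply: has_sum_lc => i; rewrite mxE; apply: pair_has_sum.
apply: eq_has_sum (has_sum_lc _ _ h1) => k.
rewrite /lcomb rmorph_sum [RHS]mulr_sumr; apply: eq_bigr => j _ /=.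
rewrite mulr_sumr mulr_sumr mulr_suml; apply: eq_bigr => i _.
by rewrite rmorphM; ring.
Qed.

Lemma gram_herm p (v : 'I_p -> fourier R) : (forall i, finite_energy q (v i)) ->
  adjmx (gram v) = gram v.
Proof.
move=> vE; apply/matrixP => i j; rewrite !mxE.
apply: has_sum_uniq (pair_has_sum (vE i) (vE j)).
apply: eq_has_sum (has_sum_conj (pair_has_sum (vE j) (vE i))) => k.
by rewrite !rmorphM /= conjcK oppr0 mulrAC.
Qed.

Lemma gram_accretive p (v : 'I_p -> fourier R) (A : 'M[C]_p) x :
  (forall i, finite_energy q (v i)) ->
  (forall i k, L (v i) k = lcomb v (row i A) k) ->
  (exists k, lcomb v x k != 0) ->
  0 < complex.Re (hform ((A - a%:C%:M) *m gram v) x x).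
Proof.
move=> vE vA [k0 xk0].
have fE : finite_energy q (lcomb v x) by apply: finite_energy_lc.
have [A1 fA hA] := energy_attained q0 fE.
have A0 : 0 < A1.
  rewrite lt_def (sum_le_ge0 fA) andbT; apply: contra xk0 => /eqP A10.
  by rewrite A10 in fA; rewrite (energy0P q0 fA).
apply: (@lt_le_trans _ _ ((1 - e) * A1)); first by rewrite mulr_gt0// subr_gt0.
apply: (accretive q0 e0 Wq Jq J1 fA hA).
have -> : hform ((A - a%:C%:M) *m gram v) x x =
    hform (gram v) (x *m (A - a%:C%:M)) x by rewrite /hform !mulmxA.
apply: eq_has_sum (gram_has_sum _ _ vE) => k; congr (_ * _ * _).
rewrite mulmxBr mul_mx_scalar -scaleNr lcombD lcombZ -(L_lcomb _ _ vE vA).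
by rewrite mulNr.
Qed.

Lemma eigenvalue_shift p (A : 'M[C]_p) b mu :
  eigenvalue (A - b%:M) mu -> eigenvalue A (mu + b).
Proof.
move=> /eigenvalueP[x xA x0]; apply/eigenvalueP; exists x => //.
by rewrite scalerDl -xA mulmxBr mul_mx_scalar subrK.
Qed.

(** The Gram matrix of v for the indefinite form satisfies the hypotheses of
    Lyapunov's theorem, so the form is negative on the span of v. If p
    exceeded the number of modes in E, a nonzero combination would vanish on
    E, and the form would be nonnegative on it. *)
Lemma index_upper p (v : 'I_p -> fourier R) (A : 'M[C]_p) :
  (forall i, finite_energy q (v i)) ->
  (forall i k, L (v i) k = lcomb v (row i A) k) ->
  (forall x, (forall k, lcomb v x k = 0) -> x = 0) ->
  (forall mu, eigenvalue A mu -> complex.Re mu < a) -> (p <= size E)%N.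
Proof.
move=> vE vA vfree Aneg; rewrite leqNgt; apply/negP => pE.
have nz x : x != 0 -> exists k, lcomb v x k != 0.
  move=> x0; apply: contrapT => /forallNP h; move/eqP: x0; apply.
  by apply: vfree => k; apply/eqP/negPn/negP/h.
have neg := lyapunov (A := A - a%:C%:M) (gram_herm vE) _
  (fun x x0 => gram_accretive vE vA (nz x x0)).
have [x x0 xE] := wide_kernel (\matrix_(i, j) v i (nth 0 E j) : 'M[C]_(p, size E)) pE.
have fE k : k \in E -> lcomb v x k = 0.
  move=> kE; have kE' : (index k E < size E)%N by rewrite index_mem.
  have := congr1 (fun M : 'rV__ => M 0 (Ordinal kE')) xE.
  rewrite !mxE => h; rewrite -[RHS]h /lcomb; apply: eq_bigr => i _.
  by rewrite mxE /= nth_index.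
have : complex.Re (hform (gram v) x x) < 0.
  apply: neg x0 => mu mu1; have := Aneg _ (eigenvalue_shift mu1).
  by rewrite ReD [complex.Re a%:C]/= -ltrBrDr subrr.
apply/negP; rewrite -leNgt.
apply: (has_sum_Re_ge (s0 := [::]) (gram_has_sum x x vE)) => s us _.
apply: sumr_ge0 => k _; have [kE|kE] := boolP (k \in E).
  by rewrite fE// mulr0 mul0r.
by rewrite /sign_in (negPf kE) -mulrA mul_conjc -rmorphM /= mul1r sqr_ge0.
Qed.

(** On an eigenvector f = lcomb g x, accretivity says that Re (mu - a) times
    the value of the form at f is positive, and that value is at most 0. *)
Lemma invariant_family_eigen (g : 'I_(size E) -> fourier R) (S : 'M[C]_(size E)) mu :
  (forall i, finite_energy q (g i)) ->
  (forall i j : 'I_(size E), g i (nth 0 E j) = (i == j)%:R) ->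
  (forall i k, L (g i) k = lcomb g (row i S) k) ->
  (forall x s, uniq s -> {subset E <= s} ->
    \sum_(k <- s) J k * cabs (lcomb g x k) ^+ 2 <= 0) ->
  eigenvalue S mu -> complex.Re mu < a.
Proof.
move=> gEn gE gS neg /eigenvalueP[x xS x0].
have [i xi] : exists i, x 0 i != 0.
  apply: contrapT => /forallNP h; move/eqP: x0; apply; apply/rowP => i.
  by rewrite mxE; apply/eqP/negPn/negP/h.
have nz : exists k, lcomb g x k != 0.
  exists (nth 0 E i); rewrite /lcomb (bigD1 i)//= gE eqxx mulr1 big1 ?addr0//.
  by move=> j ji; rewrite gE (negPf ji) mulr0.
have acc := gram_accretive gEn gS nz.
have hE : hform ((S - a%:C%:M) *m gram g) x x = (mu - a%:C) * hform (gram g) x x.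
  by rewrite -hformZl scalerBl -xS -mul_mx_scalar -mulmxBr /hform !mulmxA.
have hR := real_of_conj (esym (hform_conj x x (gram_herm gEn))).
have hneg : complex.Re (hform (gram g) x x) <= 0.
  rewrite -oppr_ge0 -ReN; apply: (has_sum_Re_ge (s0 := E)
    (u := fun k => - ((J k)%:C * lcomb g x k * conjc (lcomb g x k)))).
    rewrite -[- hform _ _ _]mulN1r.
    by apply: eq_has_sum (has_sumZ (-1) (gram_has_sum x x gEn)) => k; rewrite mulN1r.
  move=> s us Es; have := neg x s us Es; rewrite -oppr_ge0 -sumrN => h.
  rewrite (eq_bigr (fun k => - (J k * cabs (lcomb g x k) ^+ 2)))// => k _.
  by rewrite ReN -mulrA mul_conjc ReZ.
move: acc; rewrite hE hR mulrC ReZ ReD ReN [complex.Re a%:C]/= => acc.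
by nra.
Qed.

End Indefinite.

(** * Root spaces *)

Section RootSpaces.
Variable R : realType.
Local Notation C := R[i].
Implicit Types (f g : fourier R) (z mu : C).

Variables (m : nat) (W : fourier R) (q : int -> R) (e : R).

Definition free_symbol (k : int) : R := (k%:~R * pi) ^+ (2 * m).

Lemma iter_fderiv p f k :
  iter p (@fderiv R) f k = (0 +i* (k%:~R * pi)) ^+ p * f k.
Proof. by elim: p => [|p IH] /=; rewrite ?mul1r// /fderiv IH mulrA -exprS. Qed.

Lemma Lop_perturbed f : Lop m W f = perturbed free_symbol W f.
Proof.
apply/funext => k; rewrite /Lop /perturbed iter_fderiv mulrA; congr (_ * _ + _).
rewrite /free_symbol exprM [in RHS]exprM rmorphXn -exprMn; congr (_ ^+ _).
apply/eqP; rewrite eq_complex expr2 /=.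
by apply/andP; split; apply/eqP; ring.
Qed.

Hypotheses (q0 : forall k, 0 < q k) (e0 : 0 <= e) (Wq : form_small W q e).
Hypothesis qS : forall f, sobolev m%:R f <-> finite_energy q f.

Local Notation L := (perturbed free_symbol W).

Definition comb (I : Type) (r : seq I) (c : I -> C) (F : I -> fourier R) : fourier R :=
  fun k => \sum_(i <- r) c i * F i k.

Lemma LshiftE z f k : Lshift m W z f k = L f k - z * f k.
Proof. by rewrite /Lshift Lop_perturbed. Qed.

Lemma Lshift_comb I r c (F : I -> fourier R) z :
  (forall i, finite_energy q (F i)) ->
  Lshift m W z (comb r c F) = comb r c (fun i => Lshift m W z (F i)).
Proof.
move=> hF; apply/funext => k; rewrite LshiftE /perturbed /comb.
rewrite (fmul_lc q0 e0 Wq)// !mulr_sumr -big_split -sumrB; apply: eq_bigr => i _.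
by rewrite LshiftE /perturbed /=; ring.
Qed.

Definition zero_fourier : fourier R := fun=> 0.

Lemma comb_nil I c (F : I -> fourier R) : comb [::] c F = zero_fourier.
Proof. by apply/funext => k; rewrite /comb big_nil. Qed.

Lemma Lshift0 z : Lshift m W z zero_fourier = zero_fourier.
Proof.
rewrite -(comb_nil (fun _ : unit => 0) (fun=> zero_fourier)) Lshift_comb.
  by rewrite !comb_nil.
by move=> _; apply: finite_energy0.
Qed.

Lemma ker_pow0 z p : ker_pow m W z p zero_fourier.
Proof.
elim: p => [|p IH] //=; split; first exact/qS/finite_energy0.
by rewrite Lshift0.
Qed.

Lemma ker_pow_energy z p f : ker_pow m W z p f -> finite_energy q f.
Proof.
case: p => [f0|p [/qS]//]; have -> : f = zero_fourier by apply/funext.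
exact: finite_energy0.
Qed.

Lemma ker_powS z p f : ker_pow m W z p f -> ker_pow m W z p.+1 f.
Proof.
elim: p f => [|p IH] f.
  move=> f0; have -> : f = zero_fourier by apply/funext.
  exact: ker_pow0.
by move=> [fE fz]; split=> //; apply: IH.
Qed.

Lemma ker_pow_le z p p' f : (p <= p')%N -> ker_pow m W z p f -> ker_pow m W z p' f.
Proof.
move=> /subnK <-; elim: (p' - p)%N => [|n IH] //.
by move=> /IH; rewrite addSn; apply: ker_powS.
Qed.

Lemma ker_pow_comb z p I r c (F : I -> fourier R) :
  (forall i, ker_pow m W z p (F i)) -> ker_pow m W z p (comb r c F).
Proof.
elim: p F => [|p IH] F hF.
  by move=> k; rewrite /comb big1// => i _; rewrite (hF i) mulr0.
have FE i := ker_pow_energy (hF i); split.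
  by apply/qS; apply: finite_energy_lc.
by rewrite Lshift_comb//; apply: IH => i; case: (hF i).
Qed.

Lemma root_space_energy z f : root_space m W z f -> finite_energy q f.
Proof. by case=> p /ker_pow_energy. Qed.

Lemma root_space0 z : root_space m W z zero_fourier.
Proof. by exists 0%N. Qed.

Lemma root_space_comb z (I : Type) (r : seq I) c (F : I -> fourier R) :
  (forall i, root_space m W z (F i)) -> root_space m W z (comb r c F).
Proof.
move=> hF; elim: r => [|i r [p hp]]; first by rewrite comb_nil; apply: root_space0.
have [p' hp'] := hF i; exists (maxn p p').
have -> : comb (i :: r) c F =
   comb [:: true; false] (fun b => if b then c i else 1)
     (fun b => if b then F i else comb r c F).
  by apply/funext => k; rewrite /comb !big_cons big_nil addr0 mul1r.
apply: ker_pow_comb => -[].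
  by apply: ker_pow_le hp'; rewrite leq_maxr.
by apply: ker_pow_le hp; rewrite leq_maxl.
Qed.

Lemma root_space_Lshift z mu f : root_space m W z f -> root_space m W z (Lshift m W mu f).
Proof.
move=> [p fp]; have zf : root_space m W z (Lshift m W z f).
  by exists p; case: (ker_powS fp).
have -> : Lshift m W mu f = comb [:: true; false]
    (fun b => if b then 1 else z - mu) (fun b => if b then Lshift m W z f else f).
  apply/funext => k; rewrite /comb !big_cons big_nil addr0 !LshiftE; ring.
by apply: root_space_comb => -[] //; exists p.
Qed.

(** On such an f the operator L - z is multiplication by mu - z, which
    cannot be nilpotent unless mu = z. *)
Lemma root_space_eigenvalue z mu f : root_space m W z f ->
  Lshift m W mu f = zero_fourier -> f <> zero_fourier -> mu = z.
Proof.
move=> [p fp] fmu fn0; apply/eqP; rewrite -subr_eq0; apply/negPn/negP => zmu.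
apply: fn0; elim: p fp => [f0|p IH [_ fp]]; first exact/funext.
apply: IH; have fE : Lshift m W z f = comb [:: tt] (fun=> mu - z) (fun=> f).
  apply/funext => k; rewrite /comb big_cons big_nil addr0.
  have := congr1 (fun h : fourier R => h k) fmu; rewrite !LshiftE /zero_fourier => h.
  by rewrite -[L f k](subrK (mu * f k)) h; ring.
have -> : f = comb [:: tt] (fun=> (mu - z)^-1) (fun=> Lshift m W z f).
  apply/funext => k; rewrite /comb big_cons big_nil addr0 fE /comb big_cons big_nil.
  by rewrite addr0 mulKf.
exact: ker_pow_comb.
Qed.

Lemma root_space_eigenvector z f : root_space m W z f -> f <> zero_fourier ->
  exists g, [/\ finite_energy q g, Lshift m W z g = zero_fourier & g <> zero_fourier].
Proof.
move=> [p]; elim: p f => [f f0 []|p IH f [fE fp] fn0]; first exact/funext.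
have [h|h] := pselect (Lshift m W z f = zero_fourier); last exact: IH fp h.
by exists f; split=> //; apply/qS.
Qed.

(** By induction on the number of eigenvalues and on the power p that kills
    the first component: applying L - z0 lowers p, keeps the other
    components in their root spaces and is injective there. *)
Lemma root_space_independent (zs : seq C) (F : C -> fourier R) : uniq zs ->
  (forall z, root_space m W z (F z)) ->
  (forall k, \sum_(z <- zs) F z k = 0) ->
  forall z, z \in zs -> F z = zero_fourier.
Proof.
elim: zs F => [|z0 zs IH] F //= /andP[z0zs uzs] hF.
have [p Fp] := hF z0.
elim: p F hF Fp => [|p IHp] F hF Fp sF.
  have F0 : F z0 = zero_fourier by apply/funext.
  move=> z; rewrite inE => /orP[/eqP -> //|].
  apply: IH => // k; rewrite -[RHS](sF k) big_cons F0 /zero_fourier add0r //.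
pose G z := Lshift m W z0 (F z).
have G0 : forall z, z \in z0 :: zs -> G z = zero_fourier.
  apply: IHp; [by move=> z; apply: root_space_Lshift | by case: Fp|].
  move=> k; have := Lshift_comb (z0 :: zs) (fun=> 1) z0 (fun z => root_space_energy (hF z)).
  have -> : comb (z0 :: zs) (fun=> 1) F = zero_fourier.
    apply/funext => j; rewrite /comb /zero_fourier -[RHS](sF j).
    by apply: eq_bigr => z _; rewrite mul1r.
  rewrite Lshift0 => /(congr1 (fun h : fourier R => h k)) h.
  rewrite -[RHS]/(zero_fourier k) h /comb.
  by apply: eq_bigr => z _; rewrite mul1r.
have Fzs z : z \in zs -> F z = zero_fourier.
  move=> zzs; apply: contrapT => Fn0.
  have := root_space_eigenvalue (hF z) (G0 z _) Fn0; rewrite inE zzs orbT.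
  by move=> /(_ isT) z0z; rewrite z0z zzs in z0zs.
move=> z; rewrite inE => /orP[/eqP ->|]; last exact: Fzs.
apply/funext => k; rewrite -[RHS](sF k) big_cons big_seq big1 ?addr0//.
by move=> w /Fzs ->.
Qed.

End RootSpaces.

(** * Counting eigenvalues in a half-plane *)

Section Counting.
Variable R : realType.
Local Notation C := R[i].
Variables (m : nat) (W : fourier R) (q : int -> R) (a e c0 : R) (E : seq int).
Local Notation d := (@free_symbol R m).
Local Notation L := (perturbed d W).
Hypotheses (uE : uniq E) (q0 : forall k, 0 < q k) (e0 : 0 <= e) (e1 : e < 1).
Hypothesis Wq : form_small W q e.
Hypothesis Jq : forall k, sign_in R E k * (d k - a) = q k.
Hypotheses (c00 : 0 < c0) (qc0 : forall k, c0 <= q k).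
Hypothesis qS : forall f, sobolev m%:R f <-> finite_energy q f.

Variable lam : nat -> C.
Hypothesis lamP : eigenvalue_sequence m W lam.

Lemma Re_lam_homo k l : (k <= l)%N -> complex.Re (lam k) <= complex.Re (lam l).
Proof.
have [_ _ lex _] := lamP; move=> /subnK <-; elim: (l - k)%N => [|n IH] //.
by apply: le_trans IH _; rewrite addSn; case: (lex (n + k)%N) => [/ltW|[->]].
Qed.

Lemma lam_count_ex b : exists K, forall k, (complex.Re (lam k) < b) = (k < K)%N.
Proof.
have [_ _ _ /cvgryPge /(_ b)] := lamP.
case=> N _ hN; have exN : exists n, b <= complex.Re (lam n).
  by exists N; apply: hN => /=.
exists (ex_minn exN); case: ex_minnP => K aK minK k.
have [kK|Kk] := ltnP k K.
  rewrite ltNge; apply/negP => /minK; rewrite leqNgt kK //.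
by apply/negbTE; rewrite -leNgt; apply: le_trans aK (Re_lam_homo Kk).
Qed.

(** The basis provided by the algebraic multiplicity, renumbered by the
    positions k at which z occurs in lam, so that the bases of all root
    spaces are numbered at once by positions. The bound K only makes the
    sums finite. *)
Lemma root_basis z : exists v : nat -> fourier R,
  [/\ forall k, root_space m W z (v k),
    forall K f, (forall k, lam k = z -> (k < K)%N) -> root_space m W z f ->
      exists c : nat -> C, forall x, f x = \sum_(k < K | lam k == z) c k * v k x &
    forall K (c : nat -> C), (forall k, lam k = z -> (k < K)%N) ->
      (forall x, \sum_(k < K | lam k == z) c k * v k x = 0) ->
      forall k, lam k = z -> c k = 0].
Proof.
have [_ /(_ z)[n [b [bz bU]] /card_set_bijP[phi [phi1 phi2 phi3]]] _ _] := lamP.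
pose bb (i : nat) : fourier R := if insub i is Some j then b j else @zero_fourier R.
have bbE (i : 'I_n) : bb i = b i by rewrite /bb insubT //= => h; congr b; apply/val_inj.
have reindex K (F : nat -> C) : (forall k, lam k = z -> (k < K)%N) ->
    \sum_(k < K | lam k == z) F (phi k) = \sum_(i < n) F i.
  move=> hK; rewrite -(big_mkord (fun k => lam k == z) (fun k => F (phi k))).
  rewrite -(big_mkord xpredT F) -big_filter -(big_map phi xpredT F).
  apply: perm_big; apply: uniq_perm; rewrite ?iota_uniq//.
    rewrite map_inj_in_uniq ?filter_uniq ?iota_uniq// => k l.
    rewrite !mem_filter => /andP[/eqP kz _] /andP[/eqP lz _] h.
    by apply: phi2 => //; rewrite inE.
  move=> i; rewrite mem_index_iota leq0n /=; apply/mapP/idP.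
    move=> [k]; rewrite mem_filter => /andP[/eqP kz _] ->.
    exact: phi1.
  move=> ni; have [k kz <-] := phi3 i ni; exists k => //.
  by rewrite mem_filter mem_index_iota leq0n /= hK// andbT; apply/eqP.
exists (fun k => bb (phi k)); split.
- move=> k; rewrite /bb; case: insubP => [j _ _|_]; first exact: bz.
  exact: root_space0.
- move=> K f hK fz; have [c [fc _]] := bU f fz.
  pose cc i := if insub i is Some j then c j else 0.
  have ccE (i : 'I_n) : cc i = c i by rewrite /cc insubT //= => h; congr (c _); apply/val_inj.
  exists (cc \o phi) => x; rewrite fc.
  rewrite (reindex K (fun i => cc i * bb i x) hK).
  by apply: eq_bigr => i _; rewrite ccE bbE.
- move=> K c hK sc k kz.
  have /choice[psi hpsi] : forall i : 'I_n, exists l, lam l = z /\ phi l = i.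
    by move=> i; have [l lz li] := phi3 i (ltn_ord i); exists l.
  pose c1 : {ffun 'I_n -> C} := [ffun i => c (psi i)].
  have [c2 [_ c2U]] := bU (@zero_fourier R) (root_space0 m W z).
  have c20 : c2 = 0.
    by apply: c2U => x; rewrite /zero_fourier big1// => i _; rewrite ffunE mul0r.
  have phik : (phi k < n)%N by apply: phi1.
  have : c2 = c1.
    apply: c2U => x; rewrite /zero_fourier -[LHS](sc x).
    pose cc i := if insub i is Some j then c1 j else 0.
    have ccE (i : 'I_n) : cc i = c1 i.
      by rewrite /cc insubT //= => h; congr (c1 _); apply/val_inj.
    rewrite (eq_bigr (fun i : 'I_n => cc i * bb i x)); last first.
      by move=> i _; rewrite ccE bbE.
    rewrite -(reindex K (fun i => cc i * bb i x) hK); apply: eq_bigr => l /eqP lz.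
    have phil : (phi l < n)%N by apply: phi1.
    rewrite -[phi l]/(val (Ordinal phil)) ccE ffunE; congr (c _ * _).
    have [h1 h2] := hpsi (Ordinal phil); apply: esym.
    by apply: phi2; rewrite ?inE//.
  move=> /(congr1 (fun h : {ffun 'I_n -> C} => h (Ordinal phik))).
  rewrite c20 !ffunE => ->; have [h1 h2] := hpsi (Ordinal phik).
  by congr c; apply: esym; apply: phi2; rewrite ?inE.
Qed.

Lemma iter_eigenvalue n (S : 'M[C]_n) (z : C) N (x : 'rV[C]_n) :
  iter N (fun y => y *m (S - z%:M)) x = 0 -> x != 0 -> eigenvalue S z.
Proof.
elim: N x => [|N IH] x; first by move=> /= ->; rewrite eqxx.
rewrite iterSr => hx x0.
have [h|h] := eqVneq (x *m (S - z%:M)) 0; last exact: IH hx h.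
apply/eigenvalueP; exists x => //; apply/eqP.
by rewrite -subr_eq0 -mul_mx_scalar -mulmxBr h.
Qed.

(** Let K be the number of positions with real part less than a. The K root
    vectors at these positions are independent and span an invariant space,
    so K <= size E by [index_upper]. Conversely the vectors of
    [invariant_family] are sums of root vectors for eigenvalues with real
    part less than a, hence combinations of these K vectors; being
    independent, they number at most K. *)
Lemma eigenvalue_count k : (complex.Re (lam k) < a) = (k < size E)%N.
Proof.
have [K hK] := lam_count_ex a.
suff -> : size E = K by apply: hK.
have /choice[vz hvz] := root_basis.
have vzR z l : root_space m W z (vz z l) by have [h _ _] := hvz z.
have vzE z l : finite_energy q (vz z l) by apply: root_space_energy (vzR z l).
pose v (l : 'I_K) := vz (lam l) l.
have vE l : finite_energy q (v l) by apply: vzE.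
have lamK (l : 'I_K) : complex.Re (lam l) < a by rewrite hK.
have classK z : complex.Re z < a -> forall l, lam l = z -> (l < K)%N.
  by move=> za l lz; rewrite -hK lz.
pose xe (x : 'rV[C]_K) (l : nat) := if insub l is Some j then x 0 j else 0.
have xeE x (l : 'I_K) : xe x l = x 0 l.
  by rewrite /xe insubT //= => h; congr (x _ _); apply/val_inj.
(* The component in the root space of z of the combination with coefficients x. *)
pose Fz x z := comb [seq l <- index_enum 'I_K | lam (val l) == z]
    ((x : 'rV[C]_K) 0) (fun l : 'I_K => vz z l).
have FzE x z t : Fz x z t = \sum_(l < K | lam l == z) x 0 l * vz z l t.
  by rewrite /Fz /comb big_filter.
have FzR (x : 'rV[C]_K) z : root_space m W z (Fz x z) by apply: (root_space_comb q0 e0 Wq qS).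
pose zs := undup [seq lam l | l : 'I_K].
have zsP z : z \in zs -> exists l : 'I_K, z = lam l.
  by rewrite mem_undup => /mapP[l _ ->]; exists l.
have zsl (l : 'I_K) : lam l \in zs.
  by rewrite mem_undup; apply/mapP; exists l; rewrite ?mem_enum.
have sumF x t : \sum_(z <- zs) Fz x z t = lcomb v x t.
  rewrite (eq_bigr (fun z => \sum_(l < K | lam l == z) x 0 l * vz z l t)); last first.
    by move=> z _; rewrite FzE.
  rewrite (exchange_big_dep xpredT) //= /lcomb; apply: eq_bigr => l _.
  rewrite big_mkcond /= (bigD1_seq (lam l)) ?undup_uniq//= eqxx big1 ?addr0//.
  by move=> z zl; rewrite eq_sym (negPf zl).
have vfree x : (forall t, lcomb v x t = 0) -> x = 0.
  move=> h; have F0 := root_space_independent q0 e0 Wq qS (undup_uniq _) (FzR x)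
    (fun t => etrans (sumF x t) (h t)).
  apply/rowP => l; rewrite mxE -xeE; have [_ _ ind] := hvz (lam l).
  apply: (ind K) => // [|t]; first exact: classK.
  have := F0 _ (zsl l) => /(congr1 (fun f : fourier R => f t)).
  rewrite FzE => Ft; rewrite -[RHS]/(zero_fourier R t) -Ft.
  by apply: eq_bigr => i _; rewrite xeE.
have /choice[c hc] : forall l : 'I_K, exists c : nat -> C, forall t,
    L (v l) t = \sum_(j < K | lam j == lam l) c j * vz (lam l) j t.
  move=> l; have [_ span _] := hvz (lam l).
  have [c hc] := span K _ (classK _ (lamK l)) (root_space_Lshift q0 e0 Wq qS 0 (vzR (lam l) l)).
  by exists c => t; rewrite -hc LshiftE mul0r subr0.
pose A : 'M[C]_K := \matrix_(l, j) if lam j == lam l then c l j else 0.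
have vA l t : L (v l) t = lcomb v (row l A) t.
  rewrite hc /lcomb big_mkcond; apply: eq_bigr => j _; rewrite !mxE.
  by case: eqP => [jl|_]; rewrite ?mul0r// /v jl.
have Aeig mu : eigenvalue A mu -> complex.Re mu < a.
  move=> /eigenvalueP[x xA x0].
  have LF0 : forall z, z \in zs -> Lshift m W mu (Fz x z) = @zero_fourier R.
    apply: (root_space_independent q0 e0 Wq qS (undup_uniq _)).
      by move=> z; apply: (root_space_Lshift q0 e0 Wq qS mu (FzR x z)).
    move=> t; have := Lshift_comb m q0 e0 Wq zs (fun=> 1) mu
      (fun z => root_space_energy qS (FzR x z)).
    have -> : comb zs (fun=> 1) (Fz x) = lcomb v x.
      by apply/funext => u; rewrite -sumF; apply: eq_bigr => z _; rewrite mul1r.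
    move=> /(congr1 (fun f : fourier R => f t)).
    rewrite LshiftE (L_lcomb q0 e0 Wq x t vE vA) xA lcombZ subrr => h; rewrite [RHS]h.
    by apply: eq_bigr => z _; rewrite mul1r.
  have [z [zzs Fn0]] : exists z, z \in zs /\ Fz x z <> @zero_fourier R.
    apply: contrapT => /forallNP h; move/eqP: x0; apply; apply: vfree => t.
    rewrite -sumF big_seq big1// => z zzs; have := h z.
    by rewrite not_andP => -[//|/contrapT ->].
  rewrite (root_space_eigenvalue q0 e0 Wq qS (FzR x z) (LF0 z zzs) Fn0).
  by have [l ->] := zsP z zzs.
have KE : (K <= size E)%N.
  exact: (index_upper q0 e0 e1 Wq Jq c00 qc0 vE vA vfree Aeig).
have [g [S [gE gd gS gneg]]] := invariant_family uE q0 e0 e1 Wq Jq.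
have Seig mu := invariant_family_eigen q0 e0 e1 Wq Jq c00 qc0 gE gd gS gneg (mu := mu).
have span : forall x, exists y : 'rV[C]_K, forall t, lcomb g x t = lcomb v y t.
  apply: (gen_eigen_ind (S := S)).
  - exists 0 => t; rewrite /lcomb !big1// => i _; by rewrite mxE mul0r.
  - by move=> x y [x' hx] [y' hy]; exists (x' + y') => t; rewrite !lcombD hx hy.
  - move=> z N x hx; have [->|x0] := eqVneq x 0.
      exists 0 => t; rewrite /lcomb !big1// => i _; by rewrite mxE mul0r.
    have za := Seig _ (iter_eigenvalue hx x0).
    have fz : root_space m W z (lcomb g x).
      exists N; elim: N x hx {x0} => [|N IH] x hx.
        by move=> t; rewrite (hx : x = 0) /lcomb big1// => i _; rewrite mxE mul0r.
      split; first by apply/qS; apply: finite_energy_lc.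
      have -> : Lshift m W z (lcomb g x) = lcomb g (x *m (S - z%:M)).
        apply/funext => t; rewrite LshiftE (L_lcomb q0 e0 Wq x t gE gS).
        by rewrite mulmxBr mul_mx_scalar -[- (z *: x)]scaleNr lcombD lcombZ mulNr.
      by apply: IH; rewrite -iterSr.
    have [_ spanz _] := hvz z; have [b hb] := spanz K _ (classK z za) fz.
    exists (\row_l if lam l == z then b l else 0) => t.
    rewrite hb /lcomb big_mkcond; apply: eq_bigr => l _; rewrite mxE.
    by case: eqP => [lz|_]; rewrite ?mul0r// /v lz.
apply/eqP; rewrite eqn_leq KE andbT leqNgt; apply/negP => KltE.
have /choice[Y hY] : forall i : 'I_(size E), exists y : 'rV[C]_K,
    forall t, g i t = lcomb v y t.
  by move=> i; have [y hy] := span (delta_mx 0 i); exists y => t; rewrite -hy lcomb_delta.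
have [x x0 xY] := wide_kernel (\matrix_(i, l) Y i 0 l : 'M[C]_(size E, K)) KltE.
move/eqP: x0; apply; apply/rowP => j; rewrite mxE.
have <- : lcomb g x (nth 0 E j) = x 0 j.
  rewrite /lcomb (bigD1 j)//= gd eqxx mulr1 big1 ?addr0// => i ij.
  by rewrite gd (negPf ij) mulr0.
have -> : lcomb g x (nth 0 E j) = lcomb v (x *m \matrix_(i, l) Y i 0 l) (nth 0 E j).
  rewrite lcomb_mulmx /lcomb; apply: eq_bigr => i _; rewrite hY /lcomb.
  by congr (_ * _); apply: eq_bigr => l _; rewrite !mxE.
by rewrite xY /lcomb big1// => i _; rewrite mxE mul0r.
Qed.

Lemma eigenvalue_eigenvector k : exists g,
  [/\ finite_energy q g, Lshift m W (lam k) g = @zero_fourier R & g <> @zero_fourier R].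
Proof.
have [v [vR span ind]] := root_basis (lam k).
apply: (root_space_eigenvector qS (vR k)) => vk0.
have [K hK] := lam_count_ex (complex.Re (lam k) + 1).
suff : (k == k)%:R = 0 :> C by move/eqP; rewrite eqxx oner_eq0.
apply: (ind K (fun j => (j == k)%:R)) => // [j jk|t].
  by rewrite -hK jk ltrDl ltr01.
rewrite big1// => j _; case: eqP => [->|_]; last by rewrite mul0r.
by rewrite vk0 /zero_fourier mulr0.
Qed.

End Counting.

(** * The Hilbert-Schmidt estimate *)

Section Weights.
Variable R : realType.
Implicit Types (k j : int) (s t : seq int).

Definition gap (n a : nat) : nat := (maxn a n - minn a n)%N.

(** A lower bound for |d_k - z| when the real part of z is between the
    midpoints around d_n and z is at distance at least delta n^m from d_n. *)
Definition weight (m n : nat) (delta : R) (k : int) : R :=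
  if `|k|%N == n then delta * n%:R ^+ m
  else (gap n `|k| * maxn `|k| n ^ (2 * m).-1)%:R / 2.

(** The square-summable factor in the bounds on the inverse of the weight. *)
Definition recip (n : nat) (k : int) : R :=
  if `|k|%N == n then 1 else (gap n `|k|)%:R^-1.

Lemma gap_gt0 n a : a != n -> (0 < gap n a)%N.
Proof. by rewrite /gap; lia. Qed.

Lemma recip_ge0 n k : 0 <= recip n k.
Proof. by rewrite /recip; case: ifP => _; rewrite ?ler01// invr_ge0. Qed.

Lemma max_le_gap n a : (maxn a n <= n + gap n a)%N.
Proof. by rewrite /gap; lia. Qed.

Lemma gap_le_max n a : (gap n a <= maxn a n)%N.
Proof. by rewrite /gap leq_subr. Qed.

Lemma le_pred_double m : (0 < m)%N -> (m <= (2 * m).-1)%N.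
Proof. lia. Qed.

(** With a >= b this is a^(2m) - b^(2m) >= (a - b) a^(2m - 1), which holds
    because b^(2m) <= b a^(2m - 1). *)
Lemma gap_expn m n a : (0 < m)%N ->
  (gap n a * maxn a n ^ (2 * m).-1 <= maxn a n ^ (2 * m) - minn a n ^ (2 * m))%N.
Proof.
move=> m0; have -> : (2 * m)%N = (2 * m).-1.+1 by lia.
rewrite /= !expnS /gap mulnBl leq_sub2l// leq_mul2l.
by apply/orP; right; rewrite leq_exp2r; lia.
Qed.

Definition invsq (p : nat) : R := if p == 0%N then 1 else (p%:R ^+ 2)^-1.

Lemma invsq_ge0 p : 0 <= invsq p.
Proof. by rewrite /invsq; case: ifP => _; rewrite ?ler01// invr_ge0 sqr_ge0. Qed.

(** Telescoping of 1 / (p + 1)^2 <= 1 / p - 1 / (p + 1). *)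
Lemma sum_invsq N : \sum_(p <- iota 0 N.+2) invsq p <= 3 - N.+1%:R^-1.
Proof.
elim: N => [|N IH].
  rewrite /= !big_cons big_nil /invsq /= expr1n !invr1; lra.
rewrite -[N.+3]addn1 iotaD big_cat /= big_seq1 add0n.
apply: le_trans (lerD IH (lexx _)) _; rewrite /invsq /= -[N.+2%:R]natr1.
have x0 : 0 < N.+1%:R :> R by rewrite ltr0n.
set x := N.+1%:R in x0 *; have x1 : 0 < x + 1 by lra.
suff : ((x + 1) ^+ 2)^-1 <= x^-1 - (x + 1)^-1.
  by set u := _^-1; set v := x^-1; set z := (x + 1)^-1; lra.
have -> : x^-1 - (x + 1)^-1 = (x * (x + 1))^-1 by field; rewrite !gt_eqF.
by rewrite lef_pV2 ?posrE ?exprn_gt0 ?mulr_gt0// expr2 ler_pM2r// lerDl.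
Qed.

Lemma sum_invsq_uniq (t : seq nat) : uniq t -> \sum_(p <- t) invsq p <= 3.
Proof.
move=> ut; set N := (\max_(p <- t) p)%N.
apply: (@le_trans _ _ (\sum_(p <- iota 0 N.+2) invsq p)); last first.
  by apply: le_trans (sum_invsq N) _; rewrite gerBl invr_ge0.
have -> : \sum_(p <- t) invsq p = \sum_(p <- iota 0 N.+2 | p \in t) invsq p.
  rewrite -[RHS]big_filter; apply: perm_big; apply: uniq_perm => //.
    by rewrite filter_uniq// iota_uniq.
  move=> p; rewrite mem_filter mem_iota; case pt : (p \in t) => //=.
  have : (p <= N)%N by apply: (@leq_bigmax_seq _ _ xpredT id).
  lia.
rewrite big_mkcond; apply: ler_sum => p _; case: ifP => // _; exact: invsq_ge0.
Qed.

Lemma sum_invsq_int : sum_le (fun k : int => invsq `|k|%N) 6.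
Proof.
move=> s us; rewrite (bigID (fun k : int => 0 <= k)) /=.
have half (P : pred int) : (forall k l, P k -> P l -> absz k = absz l -> k = l) ->
    \sum_(k <- s | P k) invsq `|k|%N <= 3.
  move=> Pi; rewrite -big_filter -(big_map absz xpredT invsq).
  apply: sum_invsq_uniq; rewrite map_inj_in_uniq ?filter_uniq// => k l.
  by rewrite !mem_filter => /andP[kP _] /andP[lP _]; apply: Pi.
have h1 : \sum_(k <- s | 0 <= k) invsq `|k|%N <= 3.
  by apply: half => k l /= *; lia.
have h2 : \sum_(k <- s | ~~ (0 <= k)) invsq `|k|%N <= 3.
  by apply: half => k l /= *; lia.
by apply: le_trans (lerD h1 h2) _; lra.
Qed.

(** Up to sign, the gap between |k| and n is k - n or k + n, so the sum is
    at most twice the sum of inverse squares over the integers. The bound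
    does not depend on n. *)
Lemma sum_recip n : sum_le (fun k => recip n k ^+ 2) 12.
Proof.
have i1 : injective (fun k : int => k - n%:Z) by move=> k l; lia.
have i2 : injective (fun k : int => k + n%:Z) by move=> k l; lia.
apply: sum_le_le (_ : sum_le _ 12); last first.
  have -> : 12 = 6 + 6 :> R by lra.
  exact: sum_leD (sum_le_inj i1 sum_invsq_int) (sum_le_inj i2 sum_invsq_int).
move=> k /=; have e1 : recip n k ^+ 2 = invsq (gap n `|k|%N).
  rewrite /recip /invsq; case: eqP => [->|kn].
    by rewrite expr1n /gap maxnn minnn subnn.
  have : (gap n `|k| != 0)%N by rewrite -lt0n gap_gt0//; apply/eqP.
  by move=> /negPf ->; rewrite exprVn.
rewrite e1; have [k0|k0] := leP 0 k.
  have -> : gap n `|k|%N = absz (k - n%:Z) by rewrite /gap; lia.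
  by rewrite lerDl invsq_ge0.
have -> : gap n `|k|%N = absz (k + n%:Z) by rewrite /gap; lia.
by rewrite lerDr invsq_ge0.
Qed.

Section FixedWeights.
Variables (m n : nat) (delta : R).
Hypotheses (m0 : (0 < m)%N) (n0 : (0 < n)%N) (d0 : 0 < delta) (d1 : 2 * delta <= 1).

Local Notation r := (recip n).
Local Notation q := (weight m n delta).
Local Notation top k := (maxn `|k|%N n).

Lemma recip_le1 k : r k <= 1.
Proof.
rewrite /recip; case: eqP => // /eqP kn; rewrite invf_le1 ?ltr0n ?gap_gt0//.
by rewrite (ler_nat _ 1) gap_gt0.
Qed.

Lemma n_gt0 : 0 < n%:R :> R. Proof. by rewrite ltr0n. Qed.

Lemma n_expr_ge p : (0 < p)%N -> n%:R <= n%:R ^+ p :> R.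
Proof. by case: p => // p _; rewrite exprS ler_peMr ?ler0n// exprn_ege1// ler1n. Qed.

Lemma weight_gt0 k : 0 < q k.
Proof.
rewrite /weight; case: eqP => [_|/eqP kn].
  by rewrite mulr_gt0// exprn_gt0// n_gt0.
by rewrite divr_gt0// ltr0n muln_gt0 gap_gt0//= expn_gt0 leq_max n0 orbT.
Qed.

Lemma weightV_le k : (q k)^-1 <= r k / (delta * n%:R).
Proof.
have np := n_gt0; have dn : 0 < delta * n%:R by rewrite mulr_gt0.
rewrite /weight /recip; case: eqP => [_|/eqP kn].
  rewrite div1r lef_pV2 ?posrE ?mulr_gt0 ?exprn_gt0//.
  by rewrite ler_pM2l// n_expr_ge.
have gp : 0 < (gap n `|k|)%:R :> R by rewrite ltr0n gap_gt0.
rewrite natrM natrX invfM invrK invfM -mulrA ler_pM2l ?invr_gt0//.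
have Mn : n%:R <= (top k)%:R ^+ (2 * m).-1 :> R.
  apply: (le_trans (n_expr_ge (leq_trans m0 (le_pred_double m0)))).
  by rewrite lerXn2r ?nnegrE ?ler0n// ler_nat leq_maxr.
have Mp : 0 < (top k)%:R ^+ (2 * m).-1 :> R by apply: lt_le_trans Mn.
rewrite ler_pdivrMl// ler_pdivlMr// mulrA -[X in _ <= X]mul1r.
by apply: ler_pM => //; rewrite mulr_ge0// ltW.
Qed.

(** The power of M_k = max (|k|, n) nearly cancels against q k: the quotient
    is at most 2 (1 + n r_k), and n^m / delta when |k| = n. The factor n is
    then absorbed by 1 / q j, since max (|j|, n) >= n. *)
Lemma top_weight_le k j :
  (top k)%:R ^+ (2 * m) / (q k * q j) <= 6 / delta ^+ 2 * (r k ^+ 2 + r j ^+ 2).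
Proof.
have np := n_gt0; have n1 : 1 <= n%:R :> R by rewrite ler1n.
have nm1 : 1 <= n%:R ^+ m :> R by rewrite exprn_ege1.
have nm := n_expr_ge m0.
have nmp : 0 < n%:R ^+ m :> R by rewrite exprn_gt0.
have d2 : 0 < delta ^+ 2 by rewrite exprn_gt0.
have dV : 1 <= delta^-1 by rewrite invf_ge1//; have := d0; have := d1; lra.
have E2 : (2 * m)%N = (2 * m).-1.+1 by rewrite prednK// muln_gt0.
have u_eq : `|k|%N = n -> (top k)%:R ^+ (2 * m) / q k = n%:R ^+ m / delta.
  move=> kn; rewrite /weight kn eqxx maxnn mul2n -addnn exprD.
  by field; rewrite !gt_eqF.
have u_ne : `|k|%N != n -> (top k)%:R ^+ (2 * m) / q k <= 2 * (1 + n%:R * r k).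
  move=> kn; rewrite /weight /recip (negPf kn).
  have gp : 0 < (gap n `|k|)%:R :> R by rewrite ltr0n gap_gt0.
  have Mp : 0 < (top k)%:R :> R by rewrite ltr0n leq_max n0 orbT.
  have Mle : (top k)%:R <= n%:R + (gap n `|k|)%:R :> R.
    by rewrite -natrD ler_nat max_le_gap.
  rewrite [in X in X <= _]E2 exprSr natrM natrX /=; set G := (gap _ _)%:R in gp Mle *.
  set M := (top k)%:R in Mp Mle *; set Y := M ^+ _.
  have Yp : 0 < Y by rewrite exprn_gt0.
  have -> : Y * M / (G * Y / 2) = 2 * (M / G) by field; rewrite !gt_eqF.
  rewrite ler_pM2l// ler_pdivrMr// mulrDl mul1r -mulrA mulVf ?gt_eqF//.
  lra.
have w_eq : `|j|%N = n -> (q j)^-1 = (delta * n%:R ^+ m)^-1.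
  by move=> jn; rewrite /weight jn eqxx.
have w_ne : `|j|%N != n -> (q j)^-1 = 2 * r j / (top j)%:R ^+ (2 * m).-1.
  move=> jn; rewrite /weight /recip (negPf jn) natrM natrX invfM invrK.
  by rewrite invfM; ring.
have Mj1 : n%:R <= (top j)%:R :> R by rewrite ler_nat leq_maxr.
have Mjp : 0 < (top j)%:R :> R by apply: lt_le_trans Mj1.
have rk0 := recip_ge0 n k; have rj0 := recip_ge0 n j.
have rk1 := recip_le1 k; have rj1 := recip_le1 j.
have -> : (top k)%:R ^+ (2 * m) / (q k * q j) =
    ((top k)%:R ^+ (2 * m) / q k) * (q j)^-1 by rewrite invfM mulrA.
have D6 : 6 / delta ^+ 2 = 6 * delta^-1 ^+ 2 by rewrite exprVn.
have DD : delta^-1 <= delta^-1 ^+ 2 by rewrite expr2 ler_peMl// (le_trans ler01).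
rewrite D6; set D := delta^-1 in dV DD *.
have [kn|kn] := eqVneq `|k|%N n; have [jn|jn] := eqVneq `|j|%N n.
- rewrite u_eq// w_eq//.
  have -> : n%:R ^+ m / delta / (delta * n%:R ^+ m) = D ^+ 2.
    by rewrite /D; field; rewrite !gt_eqF.
  have -> : r k = 1 by rewrite /recip kn eqxx.
  have -> : r j = 1 by rewrite /recip jn eqxx.
  nra.
- rewrite u_eq// w_ne//.
  have -> : r k = 1 by rewrite /recip kn eqxx.
  have Y1 : n%:R ^+ m <= (top j)%:R ^+ (2 * m).-1 :> R.
    apply: (@le_trans _ _ (n%:R ^+ (2 * m).-1)).
      by rewrite ler_weXn2l// le_pred_double.
    by rewrite lerXn2r ?nnegrE ?ler0n.
  have Yp : 0 < (top j)%:R ^+ (2 * m).-1 :> R by rewrite exprn_gt0.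
  set Y := _ ^+ (2 * m).-1 in Y1 Yp *; set X := n%:R ^+ m in nm1 nm nmp Y1 *.
  have h : X / Y <= 1 by rewrite ler_pdivrMr// mul1r.
  have h0 : 0 <= X / Y by rewrite divr_ge0// ltW.
  have -> : X / delta * (2 * r j / Y) = 2 * D * (X / Y * r j) by rewrite /D; ring.
  have : X / Y * r j <= 1 by nra.
  nra.
- rewrite w_eq//; have -> : r j = 1 by rewrite /recip jn eqxx.
  apply: le_trans (ler_wpM2r _ (u_ne kn)) _.
    by rewrite invr_ge0 ltW// mulr_gt0.
  have -> : 2 * (1 + n%:R * r k) / (delta * n%:R ^+ m) =
    2 * D * ((1 + n%:R * r k) / n%:R ^+ m) by rewrite /D; field; rewrite !gt_eqF.
  have : (1 + n%:R * r k) / n%:R ^+ m <= 2.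
    by rewrite ler_pdivrMr//; nra.
  nra.
- rewrite w_ne//.
  have Yp : 0 < (top j)%:R ^+ (2 * m).-1 :> R by rewrite exprn_gt0.
  apply: le_trans (ler_wpM2r _ (u_ne kn)) _.
    by rewrite !mulr_ge0 ?invr_ge0// ltW.
  have Y1 : (top j)%:R <= (top j)%:R ^+ (2 * m).-1 :> R.
    rewrite -[X in X <= _]expr1 ler_weXn2l ?(leq_trans m0) ?le_pred_double//.
    exact: le_trans Mj1.
  apply: (@le_trans _ _ (4 * (r j ^+ 2 + r k * r j))).
    have gM : 1 <= (top j)%:R * r j.
      rewrite /recip (negPf jn) ler_pdivlMr ?mul1r ?ler_nat ?gap_le_max//.
      by rewrite ltr0n gap_gt0.
    have -> : 2 * (1 + n%:R * r k) * (2 * r j / (top j)%:R ^+ (2 * m).-1) =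
       4 * (r j * (1 + n%:R * r k) / (top j)%:R ^+ (2 * m).-1) by ring.
    rewrite ler_pM2l// ler_pdivrMr//.
    set Y := _ ^+ _ in Y1 Yp *; set M := (top j)%:R in Mj1 Mjp Y1 gM *.
    have a1 : 1 <= Y * r j by nra.
    have a2 : n%:R <= Y by lra.
    have -> : (r j ^+ 2 + r k * r j) * Y = r j * (Y * r j + Y * r k) by ring.
    apply: ler_wpM2l => //; nra.
  have := sqr_ge0 (r j - r k); nra.
Qed.

(** From 1 + |k - j| <= 3 max (M_k, M_j) with M_k = max (|k|, n). *)
Lemma japanese_weight_le k j :
  japanese R (k - j) ^+ (2 * m) / (q k * q j) <=
  (12 * 9 ^+ m / delta ^+ 2) * (r k ^+ 2 + r j ^+ 2).
Proof.
have qq : 0 < q k * q j by rewrite mulr_gt0 ?weight_gt0.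
have J0 : 0 <= japanese R (k - j) by rewrite /japanese addr_ge0.
have step : japanese R (k - j) ^+ (2 * m) <=
    9 ^+ m * ((top k)%:R ^+ (2 * m) + (top j)%:R ^+ (2 * m)).
  have top0 l : 0 <= (top l)%:R ^+ (2 * m) :> R by rewrite exprn_ge0.
  have -> : 9 ^+ m = 3 ^+ (2 * m) :> R by rewrite exprM; congr (_ ^+ m); ring.
  have [kj|kj] := leqP (top k) (top j).
    apply: (@le_trans _ _ ((3 * (top j)%:R) ^+ (2 * m))).
      apply: lerXn2r; rewrite ?nnegrE// ?mulr_ge0//.
      by rewrite /japanese nat1r -natrM ler_nat; lia.
    by rewrite exprMn ler_wpM2l ?exprn_ge0// lerDr.
  apply: (@le_trans _ _ ((3 * (top k)%:R) ^+ (2 * m))).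
    apply: lerXn2r; rewrite ?nnegrE// ?mulr_ge0//.
    by rewrite /japanese nat1r -natrM ler_nat; lia.
  by rewrite exprMn ler_wpM2l ?exprn_ge0// lerDl.
apply: (@le_trans _ _ (9 ^+ m * ((top k)%:R ^+ (2 * m) / (q k * q j) +
    (top j)%:R ^+ (2 * m) / (q j * q k)))).
  by rewrite (mulrC (q j)) -mulrDl mulrA ler_pM2r ?invr_gt0.
have := top_weight_le k j; have := top_weight_le j k; rewrite (addrC (r j ^+ 2)).
have : 0 <= 9 ^+ m :> R by rewrite exprn_ge0.
set X := 9 ^+ m; set A := (top k)%:R ^+ _ / _; set B := (top j)%:R ^+ _ / _.
set T := r k ^+ 2 + _; set Z := delta ^+ 2; move=> X0 hB hA.
apply: le_trans (ler_wpM2l X0 (lerD hA hB)) _.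
by rewrite le_eqVlt; apply/orP; left; apply/eqP; ring.
Qed.

(** Combines two bounds on 1 / (q k * q j), for l = k - j: the first
    compensates the growth of the coefficients of W, the second tends to 0
    as n grows. *)
Definition cutoff (W : fourier R) (l : int) : R := cabs (W l) ^+ 2 *
  Num.min (12 * 9 ^+ m / delta ^+ 2 / japanese R l ^+ (2 * m)) ((delta * n%:R) ^- 2).

Lemma japanese_ge1 l : 1 <= japanese R l.
Proof. by rewrite /japanese lerDl. Qed.

Lemma cutoff_term W k j : cabs (W (k - j)) ^+ 2 / (q k * q j) <=
  cutoff W (k - j) * (r k ^+ 2 + r j ^+ 2).
Proof.
rewrite /cutoff -mulrA; apply: ler_wpM2l; first exact: sqr_ge0.
have h0 : 0 <= r k ^+ 2 + r j ^+ 2 by rewrite addr_ge0 ?sqr_ge0.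
have J0 : 0 < japanese R (k - j) ^+ (2 * m).
  by rewrite exprn_gt0// (lt_le_trans ltr01)// japanese_ge1.
have dn : 0 < delta * n%:R by rewrite mulr_gt0// n_gt0.
have h1 := japanese_weight_le k j; rewrite mulrC -ler_pdivlMr// in h1.
have h2 : (q k * q j)^-1 <= (delta * n%:R) ^- 2 * (r k ^+ 2 + r j ^+ 2).
  rewrite invfM; apply: (@le_trans _ _ ((r k / (delta * n%:R)) * (r j / (delta * n%:R)))).
    by apply: ler_pM; rewrite ?weightV_le// invr_ge0 ltW ?weight_gt0.
  have -> : r k / (delta * n%:R) * (r j / (delta * n%:R)) =
     (delta * n%:R) ^- 2 * (r k * r j) by rewrite -exprVn; ring.
  rewrite ler_pM2l ?invr_gt0 ?exprn_gt0//.
  have := sqr_ge0 (r k - r j); have := recip_ge0 n k; have := recip_ge0 n j; nra.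
rewrite /Num.min; case: ifP => _ //.
by rewrite mulrAC.
Qed.

(** The double sum is a convolution: a function of k - j times a function of
    k or of j alone, each summable. *)
Lemma form_small_cutoff W Phi eps : sum_le (cutoff W) Phi ->
  24 * Phi <= eps ^+ 2 -> form_small W q eps.
Proof.
move=> WPhi Phie s t us ut; apply: le_trans Phie.
have Phi0 := sum_le_ge0 WPhi.
apply: (@le_trans _ _ (\sum_(k <- s) \sum_(j <- t)
    (cutoff W (k - j) * r k ^+ 2 + cutoff W (k - j) * r j ^+ 2))).
  apply: ler_sum => k _; apply: ler_sum => j _; rewrite -mulrDr.
  exact: cutoff_term.
under eq_bigr do rewrite big_split /=; rewrite big_split /=.
have h1 : \sum_(k <- s) \sum_(j <- t) cutoff W (k - j) * r k ^+ 2 <= 12 * Phi.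
  apply: (@le_trans _ _ (\sum_(k <- s) Phi * r k ^+ 2)).
    apply: ler_sum => k _; rewrite -mulr_suml ler_wpM2r ?sqr_ge0//.
    have ki : injective (fun j : int => k - j) by move=> x y; lia.
    exact: (sum_le_inj ki WPhi).
  by rewrite -mulr_sumr mulrC ler_wpM2r// sum_recip.
have h2 : \sum_(k <- s) \sum_(j <- t) cutoff W (k - j) * r j ^+ 2 <= 12 * Phi.
  rewrite exchange_big; apply: (@le_trans _ _ (\sum_(j <- t) Phi * r j ^+ 2)).
    apply: ler_sum => j _; rewrite -mulr_suml ler_wpM2r ?sqr_ge0//.
    have ki : injective (fun k : int => k - j) by move=> x y; lia.
    exact: (sum_le_inj ki WPhi).
  by rewrite -mulr_sumr mulrC ler_wpM2r// sum_recip.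
by apply: le_trans (lerD h1 h2) _; lra.
Qed.

Lemma cutoffD V W l : cutoff W l <= 2 * cutoff V l + 2 * cutoff (W \- V) l.
Proof.
rewrite /cutoff; set K := Num.min _ _.
have K0 : 0 <= K.
  rewrite le_min invr_ge0 sqr_ge0 andbT.
  have J0 : 0 <= japanese R l by apply: le_trans (japanese_ge1 l).
  by rewrite !mulr_ge0 ?invr_ge0 ?exprn_ge0// ltW.
have := ler_wpM2r K0 (cabs_sqrD (V l) ((W \- V) l)).
have -> : V l + (W \- V) l = W l by rewrite /= addrC subrK.
set x := cabs (W l) ^+ 2; set y := cabs (V l) ^+ 2; set z := cabs _ ^+ 2; lra.
Qed.

(** For smooth coefficients the second bound in the cutoff is enough, and
    only the norm matters. *)
Lemma cutoff_smooth U M :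
  sum_le (fun l => japanese R l ^+ (2 * m) * cabs (U l) ^+ 2) M ->
  sum_le (cutoff U) ((delta * n%:R) ^- 2 * M).
Proof.
move=> UM; have B0 : 0 <= (delta * n%:R) ^- 2 by rewrite invr_ge0 sqr_ge0.
apply: sum_le_le (sum_leZ B0 UM) => l; rewrite /cutoff mulrC.
apply: ler_pM; rewrite ?sqr_ge0//.
- rewrite le_min B0 andbT.
  have J0 : 0 <= japanese R l by apply: le_trans (japanese_ge1 l).
  by rewrite !mulr_ge0 ?invr_ge0 ?exprn_ge0// ltW.
- by rewrite ge_min lexx orbT.
- by rewrite ler_peMl ?sqr_ge0// exprn_ege1// japanese_ge1.
Qed.

End FixedWeights.

(** Outside a finite set that depends on V but not on n, the first bound in
    the cutoff leaves a small tail of the norm; on the finite set the second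
    bound tends to 0. *)
Lemma cutoff_rough m delta V M : 0 < delta ->
  sum_le (fun l => japanese R l ^- (2 * m) * cabs (V l) ^+ 2) M ->
  forall eta : R, 0 < eta -> exists n0, forall n, (n0 <= n)%N ->
    sum_le (cutoff m n delta V) eta.
Proof.
move=> d0 VM eta eta0; set w := (fun l => _) in VM.
have J1 l := japanese_ge1 l.
have J0 l : 0 <= japanese R l by apply: le_trans (J1 l).
have w0 l : 0 <= w l by rewrite mulr_ge0 ?sqr_ge0// invr_ge0 exprn_ge0.
set C := 12 * 9 ^+ m / delta ^+ 2.
have C0 : 0 < C by rewrite /C divr_gt0 ?mulr_gt0 ?exprn_gt0.
have [A wA hA] := sum_le_attained w0 VM.
have e1 : 0 < eta / 2 / C by apply: divr_gt0 => //; apply: divr_gt0.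
have [s0 us0 hs0] := hA _ e1.
set T := \sum_(l <- s0) cabs (V l) ^+ 2.
have T0 : 0 <= T by apply: sumr_ge0 => l _; apply: sqr_ge0.
set X := 2 * (T + 1) / (delta ^+ 2 * eta) + 1.
have X1 : 1 <= X.
  by rewrite /X lerDr divr_ge0// ?mulr_ge0 ?sqr_ge0 ?ltW// ltr_wpDl.
exists (Num.Def.truncn X).+1 => n nX s us.
have Xn : X <= n%:R.
  have := truncnS_gt X; move/ltW/le_trans; apply; by rewrite ler_nat.
rewrite (bigID (mem s0)) /=.
have near : \sum_(l <- s | l \in s0) cutoff m n delta V l <= eta / 2.
  apply: (@le_trans _ _ ((delta * n%:R) ^- 2 * T)).
    rewrite /T mulr_sumr -big_filter.
    apply: (@le_trans _ _ (\sum_(l <- [seq l <- s | l \in s0]) (delta * n%:R) ^- 2 * cabs (V l) ^+ 2)).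
      apply: ler_sum => l _; rewrite /cutoff mulrC ler_wpM2r ?sqr_ge0//.
      by rewrite ge_min lexx orbT.
    apply: sum_le_sub => [l|||l]; rewrite ?filter_uniq//.
      by rewrite mulr_ge0 ?sqr_ge0// invr_ge0 sqr_ge0.
    by rewrite mem_filter => /andP[].
  have n0 : 0 < n%:R :> R by apply: lt_le_trans Xn; lra.
  rewrite ler_pdivrMl ?exprn_gt0 ?mulr_gt0//.
  have d2 : 0 < delta ^+ 2 by rewrite exprn_gt0.
  have nn : n%:R <= n%:R ^+ 2 :> R by rewrite ler_eXnr//; lra.
  have : 2 * (T + 1) / (delta ^+ 2 * eta) <= n%:R by move: Xn; rewrite /X; lra.
  rewrite ler_pdivrMr ?mulr_gt0// exprMn => h.
  have : n%:R * (delta ^+ 2 * eta) <= n%:R ^+ 2 * (delta ^+ 2 * eta).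
    by rewrite ler_pM2r// mulr_gt0.
  move: h; set z := delta ^+ 2; set N := n%:R; nra.
have far : \sum_(l <- s | l \notin s0) cutoff m n delta V l <= eta / 2.
  apply: (@le_trans _ _ (C * \sum_(l <- s | l \notin s0) w l)).
    rewrite mulr_sumr; apply: ler_sum => l _.
    apply: (@le_trans _ _ (cabs (V l) ^+ 2 * (C / japanese R l ^+ (2 * m)))).
      by rewrite /cutoff ler_wpM2l ?sqr_ge0// ge_min lexx.
    by rewrite mulrC -mulrA.
  rewrite -ler_pdivlMl// mulrC -big_filter.
  have us' : uniq (s0 ++ [seq l <- s | l \notin s0]).
    rewrite cat_uniq us0 filter_uniq// andbT; apply/hasPn => l.
    by rewrite mem_filter => /andP[].
  by have := wA _ us'; rewrite big_cat /= => h; move: hs0; lra.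
by apply: le_trans (lerD near far) _; lra.
Qed.

End Weights.

(** * Uniformity over Sobolev balls *)

Section Sobolev.
Variable R : realType.

Lemma sobolevP s (w : int -> R) (f : fourier R) :
  (forall k, japanese R k `^ (2 * s) = w k) ->
  sobolev s f <-> exists M, sum_le (fun k => w k * cabs (f k) ^+ 2) M.
Proof.
move=> hw; have E : sobolev_sqnorm s f = \esum_(k in [set: int]) (w k * cabs (f k) ^+ 2)%:E.
  by apply: eq_esum => k _; rewrite hw.
rewrite /sobolev /= E; split=> [fin|[M hM]].
  exists (fine (\esum_(k in [set: int]) (w k * cabs (f k) ^+ 2)%:E)).
  apply: sum_le_esum; rewrite fineK// ge0_fin_numE//.
  by apply: esum_ge0 => k _; rewrite lee_fin mulr_ge0 ?sqr_ge0// -hw powR_ge0.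
apply: (@le_lt_trans _ _ M%:E); last exact: ltry.
apply: ub_ereal_sup => _ [X [fX _] <-].
rewrite fsbig_finite//= sumEFin lee_fin; exact/hM/finmap.fset_uniq.
Qed.

Lemma sobolev_norm_sum s (w : int -> R) (f : fourier R) (r : R) :
  (forall k, japanese R k `^ (2 * s) = w k) -> sobolev s f ->
  sobolev_norm s f <= r -> sum_le (fun k => w k * cabs (f k) ^+ 2) (r ^+ 2).
Proof.
move=> hw fin nr; have E : sobolev_sqnorm s f = \esum_(k in [set: int]) (w k * cabs (f k) ^+ 2)%:E.
  by apply: eq_esum => k _; rewrite hw.
have e0 : (0 <= sobolev_sqnorm s f)%E.
  by rewrite E; apply: esum_ge0 => k _; rewrite lee_fin mulr_ge0 ?sqr_ge0// -hw powR_ge0.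
apply: sum_le_esum; rewrite -E -[X in (X <= _)%E]fineK ?ge0_fin_numE// lee_fin.
have f0 : 0 <= fine (sobolev_sqnorm s f) by apply: fine_ge0.
rewrite -[X in X <= _](sqr_sqrtr f0) lerXn2r ?nnegrE ?sqrtr_ge0//.
by apply: le_trans nr; apply: sqrtr_ge0.
Qed.

Lemma japanese_powR m k : japanese R k `^ (2 * m%:R) = japanese R k ^+ (2 * m).
Proof.
by rewrite -natrM powR_mulrn// (le_trans ler01)// japanese_ge1.
Qed.

Lemma japanese_powRN m k : japanese R k `^ (2 * - m%:R) = japanese R k ^- (2 * m).
Proof. by rewrite mulrN powRN japanese_powR. Qed.

(** The rough part V is fixed and W - V enters only through the bound r on
    its norm, whence the uniformity in W. *)
Lemma form_small_uniform (m : nat) (delta eps r : R) (V : fourier R) :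
  (0 < m)%N -> 0 < delta -> 2 * delta <= 1 -> 0 < eps -> sobolev (- m%:R) V ->
  exists n0, forall n, (n0 <= n)%N -> (0 < n)%N -> forall W : fourier R,
    sobolev m%:R (W \- V) -> sobolev_norm m%:R (W \- V) <= r ->
    form_small W (weight m n delta) eps.
Proof.
move=> m0 d0 d1 eps0 /(sobolevP _ (japanese_powRN m))[M VM].
have e2 : 0 < eps ^+ 2 / 96 by rewrite divr_gt0// exprn_gt0.
have [n1 hn1] := cutoff_rough d0 VM e2.
set X := 96 * r ^+ 2 / (delta ^+ 2 * eps ^+ 2) + 1.
have X1 : 1 <= X.
  by rewrite /X lerDr; apply: divr_ge0; apply: mulr_ge0; rewrite ?sqr_ge0.
exists (maxn n1 (Num.Def.truncn X).+1) => n; rewrite geq_max => /andP[n1n nX] n0 W WV Wr.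
have Xn : X <= n%:R.
  have := truncnS_gt X; move/ltW/le_trans; apply; by rewrite ler_nat.
have np : 0 < n%:R :> R by rewrite ltr0n.
have Ur := sobolev_norm_sum (japanese_powR m) WV Wr.
have hV := hn1 n n1n; have hU := cutoff_smooth n d0 Ur.
apply: (@form_small_cutoff _ m n delta m0 n0 d0 d1 _ (eps ^+ 2 / 24)); last by lra.
have two : 0 <= 2 :> R by [].
apply: sum_le_le (_ : sum_le _ _) => [l|]; first exact: (cutoffD _ _ _ V).
move=> s us; apply: le_trans (sum_leD (sum_leZ two hV) (sum_leZ two hU) us) _.
suff : (delta * n%:R) ^- 2 * r ^+ 2 <= eps ^+ 2 / 96 by lra.
rewrite ler_pdivrMl ?exprn_gt0 ?mulr_gt0// exprMn.
have d2 : 0 < delta ^+ 2 by rewrite exprn_gt0.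
have ep2 : 0 < eps ^+ 2 by rewrite exprn_gt0.
have nn : n%:R <= n%:R ^+ 2 :> R by rewrite ler_eXnr//; lra.
have : 96 * r ^+ 2 / (delta ^+ 2 * eps ^+ 2) <= n%:R by move: Xn; rewrite /X; lra.
rewrite ler_pdivrMr ?mulr_gt0// => h.
have : n%:R * (delta ^+ 2 * eps ^+ 2) <= n%:R ^+ 2 * (delta ^+ 2 * eps ^+ 2).
  by rewrite ler_pM2r// mulr_gt0.
move: h; set z := delta ^+ 2; set N := n%:R; set y := eps ^+ 2; lra.
Qed.

End Sobolev.

(** * Levels, midpoints and asymptotics *)

Section Levels.
Variable R : realType.

Definition level (m n : nat) : R := (n%:R * pi) ^+ (2 * m).

Lemma free_symbol_level m (k : int) : free_symbol R m k = level m `|k|%N.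
Proof.
rewrite /free_symbol /level; case: k => [a|a] //=.
by rewrite NegzE mulrNz mulNr exprM sqrrN -exprM.
Qed.

Lemma level_le m a b : (a <= b)%N -> level m a <= level m b.
Proof.
move=> ab; rewrite /level lerXn2r ?nnegrE ?mulr_ge0 ?pi_ge0//.
by rewrite ler_wpM2r ?pi_ge0// ler_nat.
Qed.

Lemma level_ge0 m a : 0 <= level m a.
Proof. by rewrite exprn_ge0// mulr_ge0 ?pi_ge0. Qed.

Lemma pi_ge1 : 1 <= pi :> R.
Proof. have := pi_ge2 R; lra. Qed.

Lemma level_diff m a b : (0 < m)%N -> (a <= b)%N ->
  (b ^ (2 * m) - a ^ (2 * m))%:R <= level m b - level m a.
Proof.
move=> m0 ab; rewrite natrB; last by rewrite leq_exp2r// muln_gt0.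
rewrite /level !exprMn !natrX -mulrBl ler_peMr//.
  by rewrite subr_ge0 lerXn2r ?nnegrE ?ler0n ?ler_nat.
by rewrite exprn_ege1// pi_ge1.
Qed.

Definition mid (m n : nat) : R := (level m n.-1 + level m n) / 2.

Section Gap.
Variables (m n : nat) (delta : R).
Hypotheses (m0 : (0 < m)%N) (n0 : (0 < n)%N) (d0 : 0 < delta) (d1 : 2 * delta <= 1).
Local Notation q := (weight m n delta).
Local Notation d := (free_symbol R m).

(** The nearest point to d k among the admissible x is one of the two
    midpoints, which is at least half as far from d k as d_n is. *)
Lemma weight_le_dist x k : mid m n <= x -> x <= mid m n.+1 -> `|k|%N != n ->
  q k <= `|d k - x|.
Proof.
rewrite /mid /= => lo hi kn; rewrite /weight (negPf kn) free_symbol_level.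
set a := `|k|%N in kn *; have := gap_expn n a m0; rewrite -(ler_nat R) => gp.
move: kn; rewrite neq_ltn => /orP[an|na].
  rewrite (maxn_idPr (ltnW an)) (minn_idPl (ltnW an)) in gp *.
  have := level_diff m0 (ltnW an).
  have : level m a <= level m n.-1 by apply: level_le; rewrite -ltnS prednK.
  by rewrite distrC => h1 h2; apply: le_trans (ler_norm _); lra.
rewrite (maxn_idPl (ltnW na)) (minn_idPr (ltnW na)) in gp *.
have := level_diff m0 (ltnW na).
have : level m n.+1 <= level m a by apply: level_le.
by move=> h1 h2; apply: le_trans (ler_norm _); lra.
Qed.

(** The midpoint itself is admissible: its distance to d_n is at least n^(2m
    - 1) / 2, hence at least delta n^m. *)
Lemma weight_le_mid k : q k <= `|d k - mid m n|.
Proof.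
have [kn|kn] := eqVneq `|k|%N n; last first.
  apply: weight_le_dist => //; rewrite /mid /=.
  have h1 := level_le m (leq_pred n); have h2 := level_le m (leqnSn n).
  lra.
rewrite /weight free_symbol_level kn eqxx.
have pn : (n.-1 <= n)%N by apply: leq_pred.
have := gap_expn n n.-1 m0.
rewrite /gap (maxn_idPr pn) (minn_idPl pn) -{1}(prednK n0) subSnn mul1n.
rewrite -(ler_nat R) natrX => h1; have := level_diff m0 pn => h2.
have h3 : n%:R ^+ m <= n%:R ^+ (2 * m).-1 :> R.
  by rewrite ler_weXn2l ?le_pred_double// ler1n.
have h4 : 2 * delta * n%:R ^+ m <= n%:R ^+ m.
  by rewrite ler_piMl// exprn_ge0.
by apply: le_trans (ler_norm _); rewrite /mid; lra.
Qed.

(** Identifies the space of finite energy with the domain of the operator. *)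
Lemma weight_coercive : exists2 c, 0 < c & forall k, c * japanese R k ^+ (2 * m) <= q k.
Proof.
have np : 0 < n%:R :> R by rewrite ltr0n.
have n1 : 1 <= n%:R :> R by rewrite ler1n.
have n2 : 0 < n%:R ^+ (2 * m) :> R by rewrite exprn_gt0.
have f0 : 0 < 4 ^+ m :> R by rewrite exprn_gt0.
exists (delta / (4 * 4 ^+ m * n%:R ^+ (2 * m))) => [|k].
  by apply: divr_gt0 => //; apply: mulr_gt0 => //; apply: mulr_gt0.
set M := maxn `|k| n.
have Mp : 0 < M%:R :> R by rewrite ltr0n /M leq_max n0 orbT.
have JM : japanese R k ^+ (2 * m) <= 4 ^+ m * M%:R ^+ (2 * m).
  have -> : 4 ^+ m = 2 ^+ (2 * m) :> R by rewrite exprM; congr (_ ^+ m); ring.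
  rewrite -exprMn lerXn2r ?nnegrE ?mulr_ge0//.
    by rewrite /japanese addr_ge0.
  by rewrite /japanese nat1r -natrM ler_nat /M; lia.
apply: (@le_trans _ _ (delta * M%:R ^+ (2 * m) / (4 * n%:R ^+ (2 * m)))).
  have -> : delta * M%:R ^+ (2 * m) / (4 * n%:R ^+ (2 * m)) =
    delta / (4 * 4 ^+ m * n%:R ^+ (2 * m)) * (4 ^+ m * M%:R ^+ (2 * m)).
    by field; rewrite !gt_eqF.
  by apply: ler_wpM2l => //; apply: divr_ge0; [exact: ltW|]; rewrite !mulr_ge0// ltW.
rewrite ler_pdivrMr; last by rewrite mulr_gt0.
rewrite /weight; case: eqP => [kn|/eqP kn].
  rewrite /M kn maxnn -mulrA ler_pM2l// mulrA ler_peMl ?ltW//.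
  have : 1 <= n%:R ^+ m :> R by rewrite exprn_ege1.
  lra.
have E2 : (2 * m)%N = (2 * m).-1.+1 by rewrite prednK// muln_gt0.
have Mg : M%:R <= 2 * (n%:R * (gap n `|k|)%:R) :> R.
  rewrite -!natrM ler_nat; apply: leq_trans (max_le_gap _ _) _.
  have := gap_gt0 kn; move: n0; clear; move: (gap _ _) => g; nia.
have nn : n%:R <= n%:R ^+ (2 * m) :> R by rewrite n_expr_ge// muln_gt0.
rewrite natrM natrX -/M; set Y := M%:R ^+ (2 * m).-1.
have Y0 : 0 <= Y by rewrite exprn_ge0// ltW.
have -> : M%:R ^+ (2 * m) = Y * M%:R by rewrite [in LHS]E2 exprSr.
set G := (gap _ _)%:R in Mg *.
have G0 : 0 <= G by rewrite ler0n.
set N := n%:R in np n1 n2 Mg nn *; set X := N ^+ (2 * m) in n2 nn *.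
have h1 : Y * M%:R <= Y * (2 * (N * G)) by apply: ler_wpM2l.
have h2 : delta * (Y * M%:R) <= 1 / 2 * (Y * M%:R).
  by apply: ler_wpM2r; [rewrite mulr_ge0// ltW | have := d1; lra].
have h3 : (Y * G) * N <= (Y * G) * X by apply: ler_wpM2l; rewrite ?mulr_ge0.
by move: h1 h2 h3; set u := M%:R; nra.
Qed.

End Gap.

Definition low_modes (n : nat) : seq int :=
  [seq i%:Z - (n.-1)%:Z | i <- iota 0 (2 * n).-1].

Lemma low_modes_uniq n : uniq (low_modes n).
Proof. by rewrite map_inj_uniq ?iota_uniq// => i j; lia. Qed.

Lemma mem_low_modes n (k : int) : (0 < n)%N -> (k \in low_modes n) = (`|k| < n)%N.
Proof.
move=> n0; apply/mapP/idP => [[j]|kn].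
  by rewrite mem_iota => ? ->; lia.
exists (absz (k + (n.-1)%:Z)); last by lia.
by rewrite mem_iota; lia.
Qed.

Lemma size_low_modes n : size (low_modes n) = (2 * n).-1.
Proof. by rewrite size_map size_iota. Qed.

Lemma form_small_le (W : fourier R) (q q' : int -> R) e :
  (forall k, 0 < q k) -> (forall k, q k <= q' k) ->
  form_small W q e -> form_small W q' e.
Proof.
move=> q0 qq' Wq s t us ut; apply: le_trans (Wq s t us ut).
apply: ler_sum => k _; apply: ler_sum => j _.
have q'0 l : 0 < q' l by apply: lt_le_trans (qq' l).
rewrite ler_wpM2l ?sqr_ge0// lef_pV2 ?posrE ?mulr_gt0//.
by rewrite ler_pM// ltW.
Qed.

Section Asymptotics.
Variables (m : nat) (W : fourier R) (delta : R) (lam : nat -> R[i]).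
Hypotheses (m0 : (0 < m)%N) (d0 : 0 < delta) (d1 : 2 * delta <= 1).
Hypothesis lamP : eigenvalue_sequence m W lam.
Local Notation d := (free_symbol R m).

Lemma sobolev_energy n : (0 < n)%N -> forall f, sobolev m%:R f <->
  finite_energy (fun k => `|d k - mid m n|) f.
Proof.
move=> n0 f; rewrite (sobolevP _ (japanese_powR R m)).
have [c c0 hc] := weight_coercive m0 n0 d0 d1.
split=> [[M fM]|[M fM]].
- exists ((pi ^+ (2 * m) + `|mid m n|) * M) => s us.
  have K0 : 0 <= pi ^+ (2 * m) + `|mid m n| by rewrite addr_ge0// exprn_ge0// pi_ge0.
  apply: le_trans (sum_leZ K0 fM us); apply: ler_sum => k _.
  rewrite [X in _ <= X]mulrA ler_wpM2r ?sqr_ge0//.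
  apply: le_trans (ler_normB _ _) _; rewrite mulrDl; apply: lerD.
    rewrite free_symbol_level ger0_norm ?level_ge0// /level mulrC exprMn.
    rewrite ler_wpM2l ?exprn_ge0 ?pi_ge0//.
    by rewrite lerXn2r ?nnegrE// /japanese ?addr_ge0// lerDr.
  by rewrite ler_peMr// exprn_ege1// japanese_ge1.
- exists (c^-1 * M) => s us.
  have c1 : 0 <= c^-1 by rewrite invr_ge0 ltW.
  apply: le_trans (sum_leZ c1 fM us); apply: ler_sum => k _.
  rewrite [X in _ <= X]mulrA ler_wpM2r ?sqr_ge0// ler_pdivlMl//.
  exact: le_trans (hc k) (weight_le_mid m0 n0 d1 k).
Qed.

Lemma count_below_mid n k : (0 < n)%N -> form_small W (weight m n delta) (1 / 2) ->
  (complex.Re (lam k) < mid m n) = (k < (2 * n).-1)%N.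
Proof.
move=> n0 Wn; rewrite -size_low_modes.
have w0 := weight_gt0 m n0 d0.
have qw := weight_le_mid m0 n0 d1.
have q0 l : 0 < `|d l - mid m n| by apply: lt_le_trans (qw l).
have [c c0 hc] := weight_coercive m0 n0 d0 d1.
apply: (@eigenvalue_count _ m W (fun l => `|d l - mid m n|) (mid m n) (1 / 2) c) => //.
- exact: low_modes_uniq.
- by lra.
- exact: form_small_le Wn.
- move=> l; rewrite /sign_in mem_low_modes//; case: ltnP => ln.
    have h1 : level m `|l|%N <= level m n.-1 by apply: level_le; rewrite -ltnS prednK.
    have h2 := level_le m (leq_pred n).
    rewrite mulN1r ler0_norm// free_symbol_level /mid; lra.
  have h1 : level m n <= level m `|l|%N by apply: level_le.
  have h2 := level_le m (leq_pred n).
  rewrite mul1r ger0_norm// free_symbol_level /mid; lra.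
- move=> l; apply: le_trans (qw l); apply: le_trans (hc l).
  by rewrite ler_peMr ?(ltW c0)// exprn_ege1// japanese_ge1.
- exact: sobolev_energy.
Qed.

Lemma eigenvalue_near_level n k : (0 < n)%N ->
  form_small W (weight m n delta) (1 / 2) ->
  mid m n <= complex.Re (lam k) -> complex.Re (lam k) <= mid m n.+1 ->
  cabs (lam k - (level m n)%:C) <= delta * n%:R ^+ m.
Proof.
move=> n0 Wn lo hi; rewrite leNgt; apply/negP => far.
have w0 := weight_gt0 m n0 d0.
have qw := weight_le_mid m0 n0 d1.
have q0 l : 0 < `|d l - mid m n| by apply: lt_le_trans (qw l).
have h0 : 0 <= 1 / 2 :> R by lra.
have [g [gE gl gn0]] := eigenvalue_eigenvector (sobolev_energy n0) lamP k.
apply: gn0; apply/funext; apply: (no_eigenvector w0 h0 Wn (d := d) (z := lam k)) => [|l||l].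
- by lra.
- have [ln|ln] := eqVneq `|l|%N n.
    by rewrite /weight free_symbol_level ln eqxx cabs_distC ltW.
  apply: le_trans (weight_le_dist delta m0 n0 lo hi ln) _.
  by apply: le_trans (Re_le_cabs _); rewrite ReD ReN.
- case: gE => M gM; exists M; apply: sum_le_le gM => l.
  by rewrite ler_wpM2r ?sqr_ge0.
- have := congr1 (fun h : fourier R => h l) gl; rewrite LshiftE /zero_fourier.
  by move/eqP; rewrite subr_eq0 => /eqP.
Qed.

End Asymptotics.
End Levels.

Theorem theorem1p2 (R : realType) (m : nat) (hm : (0 < m)%N)
    (r : R) (hr : 0 <= r)
    (V : fourier R) (hV : sobolev (- m%:R) V) :
  forall delta : R, 0 < delta ->
  exists n0 : nat, (0 < n0)%N /\
    forall W : fourier R,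
      sobolev (- m%:R) W ->
      sobolev m%:R (W \- V) -> sobolev_norm m%:R (W \- V) <= r ->
    forall lam : nat -> R[i], eigenvalue_sequence m W lam ->
    forall n i : nat, (n0 <= n)%N -> (i <= 1)%N ->
      cabs (lam (2 * n - i)%N - (n%:R ^+ (2 * m) * pi ^+ (2 * m))%:C)
        <= delta * n%:R ^+ m.
Proof.
move=> delta delta0.
(* Below 1/2, the distance delta n^m is at most half of d_n - d_(n-1), which the
   midpoints need to be admissible. *)
pose d := Num.min delta (1 / 2).
have d0 : 0 < d by rewrite lt_min delta0 /=; lra.
have d1 : 2 * d <= 1.
  have : d <= 1 / 2 by rewrite ge_min lexx orbT.
  lra.
have dd : d <= delta by rewrite ge_min lexx.
have e0 : 0 < 1 / 2 :> R by lra.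
have [N hN] := form_small_uniform r hm d0 d1 e0 hV.
exists N.+1; split=> // W _ WV Wr lam lamP n i Nn i1.
have n0 : (0 < n)%N by apply: leq_trans Nn.
have small p : (n <= p)%N -> form_small W (weight m p d) (1 / 2).
  move=> np; apply: hN => //; first by apply: ltnW; apply: leq_trans np.
  exact: leq_trans np.
have lo : mid R m n <= complex.Re (lam (2 * n - i)%N).
  rewrite leNgt (count_below_mid hm d0 d1 lamP _ n0 (small n (leqnn n))).
  by rewrite -leqNgt; lia.
have hi : complex.Re (lam (2 * n - i)%N) <= mid R m n.+1.
  rewrite ltW// (count_below_mid hm d0 d1 lamP _ (ltn0Sn n) (small n.+1 (leqnSn n))).
  lia.
have := eigenvalue_near_level hm d0 d1 lamP n0 (small n (leqnn n)) lo hi.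
rewrite /level exprMn => /le_trans; apply.
by rewrite ler_wpM2r// exprn_ge0.
Qed.
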